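(* Let $(R,\mathfrak m)$ be a Cohen-Macaulay local ring of dimension two with infinite residue field and let $I,J$ be $\mathfrak m$-primary ideals of $R$. Assume that $\operatorname{depth} G(I)\ge 1$ and $\operatorname{depth} G(J)\geq 1$. Then the following statements are equivalent: (a) $r(I|J)=0$; (b) $e_{(1,0)}=e_1(I)$, $e_{(0,1)}=e_1(J)$ and $e_2(IJ)=e_2(I)+e_2(J)$; (c) there exists a joint reduction $(a,b)$ of $I$ and $J$ such that $M^1_{0,0}(a^k,b^k)=0$ for all $k\ge 1$.
   Context: $\ell$ denotes length of $R$-modules, and $I^0=J^0=R$. $G(I)=\bigoplus_{n\ge0}I^n/I^{n+1}$ is the associated graded ring of $I$. A pair $(a,b)$ is a joint reduction of $I$ and $J$ if $a\in I$, $b\in J$ and $I^{r+1}J^{s+1}=aI^rJ^{s+1}+bI^{r+1}J^s$ for all large $r,s$. One writes $r(I|J)=0$ (joint reduction number zero) if there is a joint reduction $(a,b)$ of $I$ and $J$ with $IJ=aJ+bI$. For $a\in I$, $b\in J$, $r,s\ge 0$, $k\ge1$: $M^1_{r,s}(a^k,b^k):=\dfrac{I^{r+k}J^{s+k}}{a^kI^rJ^{s+k}+b^kI^{r+k}J^s}$. Hilbert coefficients: for an $\mathfrak m$-primary ideal $K$, $\ell(R/K^n)=e_0(K)\binom{n+1}{2}-e_1(K)n+e_2(K)$ for $n\gg0$. Bigraded Hilbert coefficients $e_{(i,j)}$ of $\{I^rJ^s\}$: $\ell(R/I^rJ^s)=\sum_{i+j\le 2}(-1)^{i+j}e_{(i,j)}\binom{r+i-1}{i}\binom{s+j-1}{j}$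 for all $r,s\gg0$. *)

(* Defs.v *)
From HB Require Import structures.
From mathcomp Require Import all_boot all_order all_algebra.
From mathcomp Require Import boolp classical_sets cardinality.

Set Implicit Arguments.
Unset Strict Implicit.
Unset Printing Implicit Defensive.

Import GRing.Theory.
Local Open Scope ring_scope.
Local Open Scope classical_set_scope.
Local Open Scope quotient_scope.

(* [submodClosed V] cannot play this role: its members do not inherit from
   [zmodClosed V], which quotients require. *)
Record submodule (R : pzRingType) (V : lmodType R) := Submodule {
  mem_submodule :> {pred V};
  submodule_closed : submod_closed mem_submodule
}.

HB.instance Definition _ (R : pzRingType) (V : lmodType R) (N : submodule V) :=
  GRing.isSubmodClosed.Build R V (mem_submodule N) (submodule_closed N).

(* The unit ideal is allowed, unlike in mathcomp's [idealr]. *)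
Notation ideal R := (submodule R^o).

Declare Scope ideal_scope.
Delimit Scope ideal_scope with Idl.
Bind Scope ideal_scope with submodule.

Definition submod_type (R : pzRingType) (V : lmodType R) (N : submodule V) :=
  {v : V | v \in mem_submodule N}.

Section SubmodType.
Context {R : pzRingType} {V : lmodType R} (N : submodule V).

HB.instance Definition _ := SubChoice.on (submod_type N).
HB.instance Definition _ :=
  [SubChoice_isSubLmodule of submod_type N by <:].

End SubmodType.

(* [{ideal_quot N}] is a mere Z-module in the library (and a ring only for
   proper ideals of nontrivial rings), hence the wrappers [quot_mod] and
   [quot_ring]. *)
Definition quot_mod (R : pzRingType) (V : lmodType R) (N : submodule V) :=
  {ideal_quot (mem_submodule N)}.

Section QuotMod.
Context {R : pzRingType} {V : lmodType R} (N : submodule V).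
Local Notation Q := (quot_mod N).

HB.instance Definition _ := GRing.Zmodule.on Q.

Definition to_quot_mod (v : V) : Q := \pi_{ideal_quot (mem_submodule N)} v.

Definition quot_scale (a : R) (x : Q) : Q := to_quot_mod (a *: repr x).

Lemma to_quot_modD (u v : V) :
  to_quot_mod (u + v) = to_quot_mod u + to_quot_mod v.
Proof. exact: raddfD. Qed.

Lemma to_quot_modP (x : Q) : exists v, x = to_quot_mod v.
Proof. by exists (repr x); rewrite /to_quot_mod reprK. Qed.

Lemma to_quot_modZ a (v : V) :
  quot_scale a (to_quot_mod v) = to_quot_mod (a *: v).
Proof.
apply/eqP; rewrite -Quotient.idealrBE -scalerBr rpredZ //.
by rewrite Quotient.idealrBE reprK.
Qed.

Lemma quot_scaleA a b x : quot_scale a (quot_scale b x) = quot_scale (a * b) x.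
Proof. by have [v ->] := to_quot_modP x; rewrite !to_quot_modZ scalerA. Qed.

Lemma quot_scale1 : left_id 1 quot_scale.
Proof. by move=> x; have [v ->] := to_quot_modP x; rewrite to_quot_modZ scale1r. Qed.

Lemma quot_scaleDr : right_distributive quot_scale +%R.
Proof.
move=> a x y; have [[u ->] [v ->]] := (to_quot_modP x, to_quot_modP y).
by rewrite -to_quot_modD !to_quot_modZ scalerDr to_quot_modD.
Qed.

Lemma quot_scaleDl x : {morph quot_scale^~ x : a b / a + b}.
Proof.
move=> a b; have [v ->] := to_quot_modP x.
by rewrite !to_quot_modZ scalerDl to_quot_modD.
Qed.

HB.instance Definition _ := GRing.Zmodule_isLmodule.Build R Q
  quot_scaleA quot_scale1 quot_scaleDr quot_scaleDl.

End QuotMod.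

Section Subquotient.
Context {R : pzRingType} {V : lmodType R} (N N' : submodule V).

Definition restrict_pred : {pred submod_type N} := [pred x | val x \in N'].

Lemma restrict_closed : submod_closed restrict_pred.
Proof.
split=> [|a x y xN yN]; first by rewrite inE raddf0 rpred0.
by rewrite inE linearP rpredD // rpredZ.
Qed.

(* The module N / (N :&: N'), that is N / N' when N' is contained in N. *)
Definition subquot : lmodType R := quot_mod (Submodule restrict_closed).

End Subquotient.

Definition quot_ring (R : comPzRingType) (I : ideal R) :=
  {ideal_quot (mem_submodule I)}.

Section QuotRing.
Context {R : comPzRingType} (I : ideal R).
Local Notation Q := (quot_ring I).

HB.instance Definition _ := GRing.Zmodule.on Q.

Definition to_quot (a : R) : Q := \pi_{ideal_quot (mem_submodule I)} (a : R^o).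

Definition quot_mul (x y : Q) : Q := to_quot ((repr x : R) * (repr y : R)).

Lemma to_quotD (a b : R) : to_quot (a + b) = to_quot a + to_quot b.
Proof. exact: raddfD. Qed.

Lemma to_quotP (x : Q) : exists a, x = to_quot a.
Proof. by exists (repr x); rewrite /to_quot reprK. Qed.

Lemma to_quotM (a b : R) : quot_mul (to_quot a) (to_quot b) = to_quot (a * b).
Proof.
have toI (c : R^o) : (repr (to_quot c) - c : R^o) \in I.
  by rewrite Quotient.idealrBE reprK.
apply/eqP; rewrite -Quotient.idealrBE.
have := toI a; have := toI b.
set a' : R := repr (to_quot a); set b' : R := repr (to_quot b) => bI aI.
have -> : a' * b' - a * b = a' *: (b' - b : R^o) + b *: (a' - a : R^o).
  rewrite /GRing.scale /= !mulrBr addrA [b * a']mulrC subrK.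
  by rewrite [b * a]mulrC.
by rewrite rpredD // rpredZ.
Qed.

Lemma quot_mulA : associative quot_mul.
Proof.
move=> x y z; have [[[a ->] [b ->]] [c ->]] :=
  (to_quotP x, to_quotP y, to_quotP z).
by rewrite !to_quotM mulrA.
Qed.

Lemma quot_mulC : commutative quot_mul.
Proof.
move=> x y; have [[a ->] [b ->]] := (to_quotP x, to_quotP y).
by rewrite !to_quotM mulrC.
Qed.

Lemma quot_mul1 : left_id (to_quot 1) quot_mul.
Proof. by move=> x; have [a ->] := to_quotP x; rewrite to_quotM mul1r. Qed.

Lemma quot_mulDl : left_distributive quot_mul +%R.
Proof.
move=> x y z; have [[[a ->] [b ->]] [c ->]] :=
  (to_quotP x, to_quotP y, to_quotP z).
by rewrite -to_quotD !to_quotM mulrDl to_quotD.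
Qed.

HB.instance Definition _ := GRing.Zmodule_isComPzRing.Build Q
  quot_mulA quot_mulC quot_mul1 quot_mulDl.

End QuotRing.

Section IdealGen.
Context {R : pzRingType} (S : set R).

Definition ideal_gen_pred : {pred R^o} :=
  fun x => `[< forall K : ideal R, (forall y, S y -> y \in K) -> x \in K >].

Lemma ideal_gen_closed : submod_closed ideal_gen_pred.
Proof.
split=> [|a x y /asboolP xS /asboolP yS]; apply/asboolP=> K SK.
  exact: rpred0.
by rewrite rpredD ?rpredZ ?xS ?yS.
Qed.

Definition ideal_gen : ideal R := Submodule ideal_gen_closed.

Lemma mem_ideal_gen x : S x -> x \in ideal_gen.
Proof. by move=> Sx; apply/asboolP=> K; apply. Qed.

Lemma ideal_gen_min (K : ideal R) :
  (forall y, S y -> y \in K) -> {subset ideal_gen <= K}.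
Proof. by move=> SK x /asboolP; apply. Qed.

End IdealGen.

Section IdealOps.
Context {R : comPzRingType}.
Implicit Types I J : ideal R.

Definition principal (a : R) : ideal R := ideal_gen [set a].

Definition ideal_add I J : ideal R := ideal_gen [set x | x \in I \/ x \in J].

Definition ideal_mul I J : ideal R :=
  ideal_gen [set z : R | exists x y : R, [/\ x \in I, y \in J & z = x * y]].

Definition ideal_exp I n : ideal R := iter n (ideal_mul I) (ideal_gen setT).

End IdealOps.

Arguments principal {R} a%_R.
Arguments ideal_add {R} (I J)%_Idl : simpl never.
Arguments ideal_mul {R} (I J)%_Idl : simpl never.
Arguments ideal_exp {R} I%_Idl n%_N : simpl never.
Notation "I + J" := (ideal_add I J) : ideal_scope.
Notation "I * J" := (ideal_mul I J) : ideal_scope.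
Notation "I ^+ n" := (ideal_exp I n) : ideal_scope.
Notation "a *: I" := (ideal_mul (principal a) I) : ideal_scope.

Section IdealOpsTheory.
Context {R : comPzRingType}.
Implicit Types I J K : ideal R.

Lemma mem_ideal_mul I J (x y : R) : x \in I -> y \in J -> x * y \in (I * J)%Idl.
Proof. by move=> xI yJ; apply: mem_ideal_gen; exists x, y. Qed.

Lemma mem_ideal0 K : (0 : R) \in K.
Proof. exact: (rpred0 (mem_submodule K)). Qed.

Lemma mem_idealD K (x y : R) : x \in K -> y \in K -> x + y \in K.
Proof. exact: (@rpredD R^o (mem_submodule K)). Qed.

Lemma mem_idealB K (x y : R) : x \in K -> y \in K -> x - y \in K.
Proof. exact: (@rpredB R^o (mem_submodule K)). Qed.

Lemma mem_ideal_sum K n (F : 'I_n -> R) :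
  (forall i, F i \in K) -> \sum_i F i \in K.
Proof.
by move=> FK; elim/big_ind: _ => //; [apply: mem_ideal0 | apply: mem_idealD].
Qed.

Lemma mem_idealMl K (a x : R) : x \in K -> a * x \in K.
Proof. by move=> xK; exact: (rpredZ a xK). Qed.

Lemma ideal_mul_min I J K :
  (forall x y : R, x \in I -> y \in J -> x * y \in K) ->
  {subset (I * J)%Idl <= K}.
Proof. by move=> IJK; apply: ideal_gen_min => _ [x [y [xI yJ ->]]]; apply: IJK. Qed.

Section Colon.
Variables (K : ideal R) (y : R).

Definition colon_pred : {pred R^o} := [pred x | (x : R) * y \in K].

Lemma colon_closed : submod_closed colon_pred.
Proof.
split=> [|a u v uK vK]; rewrite inE; first by rewrite mul0r; apply: rpred0.
by rewrite mulrDl; apply: rpredD => //; rewrite -mulrA; apply: mem_idealMl.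
Qed.

End Colon.

Lemma mem_ideal_exp I i j (x y : R) :
  x \in (I ^+ i)%Idl -> y \in (I ^+ j)%Idl -> x * y \in (I ^+ (i + j))%Idl.
Proof.
elim: i x => [|i IH] x xI yI; first exact: mem_idealMl.
pose C := Submodule (colon_closed (I ^+ (i.+1 + j))%Idl y).
apply: (ideal_mul_min (K := C) _ xI) => u v uI vI.
change (u * v * y \in (I ^+ (i.+1 + j))%Idl); rewrite -mulrA.
exact: mem_ideal_mul uI (IH _ vI yI).
Qed.

End IdealOpsTheory.

Definition is_maximum (P : nat -> Prop) (n : nat) :=
  P n /\ forall k, P k -> (k <= n)%N.

(* [C 0, ..., C n] is strictly increasing; the [C i] for [i > n] are
   irrelevant. *)
Definition strict_chain (T : Type) (C : nat -> {pred T}) (n : nat) :=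
  forall i, (i < n)%N ->
    {subset C i <= C i.+1} /\ ~ {subset C i.+1 <= C i}.

Definition has_length (R : pzRingType) (V : lmodType R) :=
  is_maximum (fun n => exists N : nat -> submodule V, strict_chain N n).

Section LocalRings.
Context {R : comNzRingType}.
Implicit Types I m : ideal R.

Definition proper I := (1 : R) \notin I.

Definition prime_ideal I := proper I /\ prime_idealr_closed (I : {pred R}).

Definition maximal_ideal m :=
  proper m /\ forall I, proper I -> {subset m <= I} -> {subset I <= m}.

Definition is_local m :=
  maximal_ideal m /\ forall m' : ideal R, maximal_ideal m' -> m' =i m.

Definition radical I : {pred R} := fun x => `[< exists n, x ^+ n \in I >].

Definition primary_ideal I :=
  proper I /\
  forall x y : R, x * y \in I -> x \notin I -> y \in radical I.

Definition is_primary_to m I := primary_ideal I /\ radical I =i m.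

End LocalRings.

Definition noetherian (R : comNzRingType) :=
  forall I : ideal R, exists s : seq R, I =i ideal_gen [set` s].

Definition krull_dim (R : comNzRingType) :=
  is_maximum (fun n => exists P : nat -> ideal R,
    (forall i, (i <= n)%N -> prime_ideal (P i)) /\ strict_chain P n).

Definition regular_seq (A : comPzRingType) (s : seq A) :=
  (1 : A) \notin ideal_gen [set` s] /\
  forall i, (i < size s)%N -> forall y : A,
    s`_i * y \in ideal_gen [set` take i s] ->
    y \in ideal_gen [set` take i s].

Definition regular_seq_in (A : comPzRingType) (M : ideal A) (n : nat) :=
  exists s : seq A,
    [/\ size s = n, forall x, x \in s -> x \in M & regular_seq s].

(* As the length and the dimension, the depth is a supremum, here of the lengths
   of the regular sequences in [M]; [has_depth] asserts that it is finite,
   [depth_ge] does not. *)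
Definition has_depth (A : comPzRingType) (M : ideal A) :=
  is_maximum (regular_seq_in M).

Definition depth_ge (A : comPzRingType) (M : ideal A) (d : nat) :=
  exists2 n, (d <= n)%N & regular_seq_in M n.

Definition cohen_macaulay (R : comNzRingType) (m : ideal R) :=
  noetherian R /\ exists2 d, krull_dim R d & has_depth m d.

(* The Rees algebra \bigoplus_n I^n t^n, as a subring of R[t]. *)
Definition rees_pred (R : comNzRingType) (I : ideal R) : {pred {poly R}} :=
  fun p => `[< forall n, p`_n \in (I ^+ n)%Idl >].

Lemma rees_closed (R : comNzRingType) (I : ideal R) :
  subring_closed (rees_pred I).
Proof.
split=> [|p q /asboolP pI /asboolP qI|p q /asboolP pI /asboolP qI];
  apply/asboolP=> n.
- rewrite coef1; case: n => [|n]; first exact: mem_ideal_gen.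
  exact: mem_ideal0.
- by rewrite coefB; apply: mem_idealB.
- rewrite coefM; apply: mem_ideal_sum => i.
  by have := mem_ideal_exp (pI i) (qI (n - i)%N); rewrite subnKC // -ltnS.
Qed.

HB.instance Definition _ (R : comNzRingType) (I : ideal R) :=
  GRing.isSubringClosed.Build {poly R} (rees_pred I) (rees_closed I).

Definition rees (R : comNzRingType) (I : ideal R) :=
  {p : {poly R} | p \in rees_pred I}.

Section AssociatedGraded.
Context {R : comNzRingType} (I : ideal R).

HB.instance Definition _ := SubChoice.on (rees I).
HB.instance Definition _ := [SubChoice_isSubComNzRing of rees I by <:].

(* \bigoplus_n I^(n+1) t^n *)
Definition gr_ideal_pred : {pred (rees I)^o} :=
  fun p => `[< forall n, (val p)`_n \in (I ^+ n.+1)%Idl >].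

Lemma gr_ideal_closed : submod_closed gr_ideal_pred.
Proof.
split=> [|a p q /asboolP pI /asboolP qI]; apply/asboolP=> n.
  by rewrite raddf0 coef0; apply: mem_ideal0.
have -> : val (a *: p + q) = val (a : rees I) * val (p : rees I) + val q.
  rewrite -(rmorphM (val : rees I -> {poly R})).
  exact: (rmorphD (val : rees I -> {poly R})).
rewrite coefD; apply: mem_idealD => //.
rewrite coefM; apply: mem_ideal_sum => i; have /asboolP aI := valP a.
by have := mem_ideal_exp (aI i) (pI (n - i)%N); rewrite addnS subnKC // -ltnS.
Qed.

(* G(I) = \bigoplus_n I^n / I^(n+1) *)
Definition assoc_graded : comPzRingType :=
  quot_ring (Submodule gr_ideal_closed).

(* When [m] is maximal and contains [I], this is the maximal homogeneous ideal
   m/I + \bigoplus_(n > 0) I^n / I^(n+1) of G(I). *)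
Definition gr_max (m : ideal R) : ideal assoc_graded :=
  ideal_gen [set to_quot (Submodule gr_ideal_closed) p |
             p in [set p : rees I | (val p)`_0 \in m]].

End AssociatedGraded.

Section JointReductions.
Context {R : comNzRingType} (I J : ideal R).

Definition joint_reduction (a b : R) :=
  [/\ a \in I, b \in J &
      exists N, forall r s, (N <= r)%N -> (N <= s)%N ->
        (I ^+ r.+1 * J ^+ s.+1)%Idl =i
        (a *: (I ^+ r * J ^+ s.+1) + b *: (I ^+ r.+1 * J ^+ s))%Idl].

Definition joint_reduction_number_zero :=
  exists a b, joint_reduction a b /\
    (I * J)%Idl =i (a *: J + b *: I)%Idl.

(* M^1_{r,s}(a^k, b^k); the second ideal is contained in the first one when
   a is in I and b is in J. *)
Definition M1 (r s : nat) (a b : R) (k : nat) : lmodType R :=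
  subquot (I ^+ (r + k) * J ^+ (s + k))%Idl
    (a ^+ k *: (I ^+ r * J ^+ (s + k)) + b ^+ k *: (I ^+ (r + k) * J ^+ s))%Idl.

End JointReductions.

Section HilbertCoefficients.
Context {R : comNzRingType}.
Implicit Types I J K : ideal R.

Definition is_hilbert_coeff K (e : nat -> int) :=
  exists N, forall n, (N <= n)%N ->
    exists2 l, has_length (quot_mod (K ^+ n)%Idl) l &
      l%:Z = e 0%N * 'C(n.+1, 2)%:Z - e 1%N * n%:Z + e 2%N.

(* "The" coefficients e_i(K), by definite description: in dimension two, and for
   [K] primary to the maximal ideal, they exist and are unique for i <= 2. The
   values for i > 2 are unconstrained. *)
Definition hilbert_coeff K : nat -> int :=
  xget (fun=> 0) [set e | is_hilbert_coeff K e].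

Definition is_bigraded_coeff I J (e : nat -> nat -> int) :=
  exists N, forall r s, (N <= r)%N -> (N <= s)%N ->
    exists2 l, has_length (quot_mod (I ^+ r * J ^+ s)%Idl) l &
      l%:Z = \sum_(i < 3) \sum_(j < 3 | (i + j <= 2)%N)
        (-1) ^+ (i + j) * e i j *
        'C((r + i).-1, i)%:Z * 'C((s + j).-1, j)%:Z.

(* Likewise for the coefficients e_(i,j), with i + j <= 2. *)
Definition bigraded_coeff I J : nat -> nat -> int :=
  xget (fun _ _ => 0) [set e | is_bigraded_coeff I J e].

End HilbertCoefficients.

(* Main.v *)
Require Import Defs.
From HB Require Import structures.
From mathcomp Require Import all_boot all_order all_algebra ring zify.
From mathcomp Require Import boolp classical_sets cardinality.

(* Write l(K) for the length of R / K. If (a, b) is a regular sequence generating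
   an m-primary ideal, and A, B are m-primary, then

     l(a A + b B) = l(a, b) + l(A) + l(B) - l((A : b) /\ (B : a)).

   If (a, b) is a joint reduction of I and J, this shows that the mixed second
   difference of l(I^r J^s) is l(a, b) + E(r, s) for large r and s, where
   E(r, s) >= 0 and the sum of all E(r, s) is finite. Hence E vanishes for large
   r and s, which yields the Hilbert polynomials, with e_(1,1) = l(a, b). Joint
   reductions exist by a bigraded version of the Eakin-Sathaye theorem, because
   the number of generators of I^n J^n grows only linearly with n.

   Applied to a^r, b^s, A = J^s and B = I^r, the same formula gives
   l(I^r J^s) <= r s l(a, b) + l(I^r) + l(J^s), with equality if and only if
   I^r J^s = a^r J^s + b^s I^r. If I J = a J + b I, then equality holds for all
   r and s, and (b) and (c) follow. Conversely, (b) gives equality for large r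
   and s. Since G(I) and G(J) have positive depth, a and b can be chosen with
   (I^(n+1) : a) = I^n and (J^(n+1) : b) = J^n for all n, and cancelling
   a^(r-1) b^(s-1) in I^r J^s = a^r J^s + b^s I^r yields I J = a J + b I. *)

Set Implicit Arguments.
Unset Strict Implicit.
Unset Printing Implicit Defensive.

Import GRing.Theory.
Local Open Scope ring_scope.
Local Open Scope classical_set_scope.

(** * The semiring of ideals *)

(** All length formulas come from the exact sequence 0 -> R/(K : c) -> R/K -> R/(K + (c)) -> 0. The
    sum of the E(r, s) over r < k and s < l telescopes; it is bounded because, up to a shift of
    exponents, I^k J^l contains a^k J^l + b^l I^k, whose length the formula controls.

    Generic choices are made along lines: a condition on (x, y) counts as open if, on each line
    through a point where it holds, it fails for boundedly many parameters that are pairwise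
    incongruent modulo m. As the residue field is infinite, finitely many satisfiable open
    conditions hold simultaneously somewhere. The colon conditions on a and b are established only
    on a pencil a1 + t a2 spanned by a reduction, so a and b are chosen in turn. Positive depth
    enters through (I^(n+1) : I) = I^n.

    Condition (b) is silent on the coefficients that always agree: e_(2,0) = e_0(I) and e_(0,2) =
    e_0(J). Restriction to r = s shows that e_2(IJ) is e_(0,0). *)

Section IdealSemiring.
Context {R : comPzRingType}.
Implicit Types (A B C : ideal R) (x y z : R).

Lemma ideal_ext A B : (forall x : R, (x \in A) = (x \in B)) -> A = B.
Proof.
case: A B => [p pP] [q qP] /= eq_pq.
have e : p = q by apply: funext => x; exact: eq_pq.
by case: _ / e qP eq_pq => qP _; rewrite (Prop_irrelevance pP qP).
Qed.

Lemma ideal_anti A B : {subset A <= B} -> {subset B <= A} -> A = B.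
Proof. by move=> AB BA; apply: ideal_ext => x; apply/idP/idP => [/AB|/BA]. Qed.

Lemma mem_ideal_add A B z :
  reflect (exists x y : R, [/\ x \in A, y \in B & z = x + y])
    (z \in (A + B)%Idl).
Proof.
apply: (iffP idP) => [|[x [y [xA yB ->]]]]; last first.
  by apply: mem_idealD; apply: mem_ideal_gen; [left|right].
pose P : {pred R^o} :=
  fun z => `[< exists x y : R, [/\ x \in A, y \in B & z = x + y] >].
have Pc : submod_closed P.
  split=> [|c _ _ /asboolP[x [y [xA yB ->]]] /asboolP[x' [y' [xA' yB' ->]]]];
    apply/asboolP.
    by exists 0, 0; rewrite !mem_ideal0 addr0.
  exists (c * x + x'), (c * y + y'); split.
  - by apply: mem_idealD => //; apply: mem_idealMl.
  - by apply: mem_idealD => //; apply: mem_idealMl.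
  - by rewrite /GRing.scale /=; ring.
move=> /(ideal_gen_min (K := Submodule Pc)) H.
apply/asboolP/H => y [yA|yB]; apply/asboolP.
  by exists y, 0; rewrite mem_ideal0 addr0.
by exists 0, y; rewrite mem_ideal0 add0r.
Qed.

Lemma mem_principal_mul a A z :
  reflect (exists2 x : R, x \in A & z = a * x) (z \in (a *: A)%Idl).
Proof.
apply: (iffP idP) => [|[x xA ->]]; last first.
  by apply: mem_ideal_mul => //; apply: mem_ideal_gen.
pose P : {pred R^o} := fun z => `[< exists2 x : R, x \in A & z = a * x >].
have Pc : submod_closed P.
  split=> [|c _ _ /asboolP[x xA ->] /asboolP[y yA ->]]; apply/asboolP.
    by exists 0; rewrite ?mem_ideal0 ?mulr0.
  exists (c * x + y); first by apply: mem_idealD => //; apply: mem_idealMl.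
  by rewrite /GRing.scale /=; ring.
suff H : {subset (a *: A)%Idl <= Submodule Pc} by move/H/asboolP.
apply: ideal_mul_min => x y xa yA.
pose Q : {pred R^o} := fun z => `[< exists r, z = r * a >].
have Qc : submod_closed Q.
  split=> [|c _ _ /asboolP[u ->] /asboolP[v ->]]; apply/asboolP.
    by exists 0; rewrite mul0r.
  by exists (c * u + v); rewrite /GRing.scale /=; ring.
have /asboolP[r ->] : x \in Submodule Qc.
  by apply: ideal_gen_min xa => _ ->; apply/asboolP; exists 1; rewrite mul1r.
apply/asboolP; exists (r * y); first exact: mem_idealMl.
ring.
Qed.

Lemma mem_ideal_gen0 x : (x \in ideal_gen (@set0 R)) = (x == 0).
Proof.
have Zc : submod_closed ([pred x : R^o | x == 0]).
  split=> [|a u v]; rewrite !inE // => /eqP-> /eqP->.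
  by rewrite scaler0 addr0.
apply/idP/eqP => [/(ideal_gen_min (K := Submodule Zc)) H|->].
  by apply/eqP/H.
exact: mem_ideal0.
Qed.

Lemma mem_ideal_genT x : x \in ideal_gen (@setT R).
Proof. exact: mem_ideal_gen. Qed.

Fact ideal_addA : associative (@ideal_add R).
Proof.
move=> A B C; apply: ideal_anti => z /mem_ideal_add[x [y [+ + ->]]].
  move=> xA /mem_ideal_add[u [v [uB vC ->]]]; apply/mem_ideal_add.
  exists (x + u), v; rewrite addrA; split=> //; apply/mem_ideal_add.
  by exists x, u.
move=> /mem_ideal_add[u [v [uA vB ->]]] yC; apply/mem_ideal_add.
exists u, (v + y); rewrite addrA; split=> //; apply/mem_ideal_add.
by exists v, y.
Qed.

Fact ideal_addC : commutative (@ideal_add R).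
Proof.
by move=> A B; apply: ideal_anti => z /mem_ideal_add[x [y [xA yB ->]]];
  apply/mem_ideal_add; exists y, x; rewrite addrC.
Qed.

Fact ideal_add0 : left_id (ideal_gen (@set0 R)) (@ideal_add R).
Proof.
move=> A; apply: ideal_anti => z.
  move=> /mem_ideal_add[x [y [+ yA ->]]].
  by rewrite mem_ideal_gen0 => /eqP->; rewrite add0r.
move=> zA; apply/mem_ideal_add; exists 0, z.
by rewrite mem_ideal_gen0 eqxx add0r.
Qed.

Fact ideal_mulC : commutative (@ideal_mul R).
Proof.
by move=> A B; apply: ideal_anti; apply: ideal_mul_min => x y xA yB;
  rewrite mulrC; apply: mem_ideal_mul.
Qed.

Fact ideal_mulA : associative (@ideal_mul R).
Proof.
have H A B C : {subset (A * (B * C))%Idl <= (A * B * C)%Idl}.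
  apply: ideal_mul_min => x y xA yBC; rewrite mulrC.
  pose K := Submodule (colon_closed (A * B * C)%Idl x).
  apply: (ideal_mul_min (K := K) _ yBC) => u v uB vC.
  change (u * v * x \in (A * B * C)%Idl).
  have -> : u * v * x = x * u * v by ring.
  by apply: mem_ideal_mul => //; apply: mem_ideal_mul.
move=> A B C; apply: ideal_anti; first exact: H.
rewrite (ideal_mulC (A * B)%Idl) (ideal_mulC A B) (ideal_mulC A) (ideal_mulC B C).
exact: H.
Qed.

Fact ideal_mul1 : left_id (ideal_gen (@setT R)) (@ideal_mul R).
Proof.
move=> A; apply: ideal_anti => [|x xA].
  by apply: ideal_mul_min => x y _; apply: mem_idealMl.
by rewrite -[x]mul1r; apply: mem_ideal_mul => //; apply: mem_ideal_genT.
Qed.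

Fact ideal_mulD : left_distributive (@ideal_mul R) (@ideal_add R).
Proof.
move=> A B C; apply: ideal_anti.
  apply: ideal_mul_min => _ z /mem_ideal_add[x [y [xA yB ->]]] zC.
  apply/mem_ideal_add; exists (x * z), (y * z).
  by rewrite mulrDl; split=> //; apply: mem_ideal_mul.
move=> _ /mem_ideal_add[x [y [xAC yBC ->]]]; apply: mem_idealD.
  apply: ideal_mul_min xAC => u v uA vC; apply: mem_ideal_mul => //.
  by apply: mem_ideal_gen; left.
apply: ideal_mul_min yBC => u v uA vC; apply: mem_ideal_mul => //.
by apply: mem_ideal_gen; right.
Qed.

Fact ideal_mul0 : left_zero (ideal_gen (@set0 R)) (@ideal_mul R).
Proof.
move=> A; apply: ideal_anti => [|x]; last first.
  by rewrite mem_ideal_gen0 => /eqP->; exact: mem_ideal0.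
apply: ideal_mul_min => x y; rewrite mem_ideal_gen0 => /eqP-> _.
by rewrite mul0r mem_ideal0.
Qed.

End IdealSemiring.

(* The universe of [ideal R] is too large for the structures of mathcomp,
   because of the [{pred _}] it contains; [idl R] is a small copy of it. *)
Record idl (R : comPzRingType) := Idl {
  idl_pred : R -> bool;
  idl_closed : submod_closed (idl_pred : {pred R^o})
}.

Coercion idl_mem (R : comPzRingType) (A : idl R) : {pred R} := idl_pred A.

Coercion idl_ideal (R : comPzRingType) (A : idl R) : ideal R :=
  Submodule (idl_closed A).

Definition of_ideal (R : comPzRingType) (A : ideal R) : idl R :=
  @Idl R (mem_submodule A) (submodule_closed A).

Lemma idl_idealK (R : comPzRingType) (A : idl R) : of_ideal A = A.
Proof. by case: A. Qed.

Lemma of_idealK (R : comPzRingType) (A : ideal R) : idl_ideal (of_ideal A) = A.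
Proof. by case: A. Qed.

HB.instance Definition _ (R : comPzRingType) := gen_eqMixin (idl R).
HB.instance Definition _ (R : comPzRingType) := gen_choiceMixin (idl R).

Section IdlSemiring.
Context {R : comPzRingType}.
Implicit Types A B : idl R.

Definition idl_zero : idl R := of_ideal (ideal_gen set0).
Definition idl_one : idl R := of_ideal (ideal_gen setT).
Definition idl_add A B : idl R := of_ideal (ideal_add A B).
Definition idl_mul A B : idl R := of_ideal (ideal_mul A B).

Fact idl_addA : associative idl_add.
Proof. by move=> A B C; rewrite /idl_add !of_idealK ideal_addA. Qed.

Fact idl_addC : commutative idl_add.
Proof. by move=> A B; rewrite /idl_add ideal_addC. Qed.

Fact idl_add0 : left_id idl_zero idl_add.
Proof. by move=> A; rewrite /idl_add of_idealK ideal_add0 idl_idealK. Qed.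

Fact idl_mulA : associative idl_mul.
Proof. by move=> A B C; rewrite /idl_mul !of_idealK ideal_mulA. Qed.

Fact idl_mulC : commutative idl_mul.
Proof. by move=> A B; rewrite /idl_mul ideal_mulC. Qed.

Fact idl_mul1 : left_id idl_one idl_mul.
Proof. by move=> A; rewrite /idl_mul of_idealK ideal_mul1 idl_idealK. Qed.

Fact idl_mulD : left_distributive idl_mul idl_add.
Proof.
by move=> A B C; rewrite /idl_mul /idl_add !of_idealK ideal_mulD.
Qed.

Fact idl_mul0 : left_zero idl_zero idl_mul.
Proof. by move=> A; rewrite /idl_mul /idl_zero of_idealK ideal_mul0. Qed.

HB.instance Definition _ :=
  GRing.isNmodule.Build (idl R) idl_addA idl_addC idl_add0.
HB.instance Definition _ :=
  GRing.Nmodule_isComPzSemiRing.Build (idl R)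
    idl_mulA idl_mulC idl_mul1 idl_mulD idl_mul0.

End IdlSemiring.

Definition pri (R : comPzRingType) (a : R) : idl R := of_ideal (principal a).

Definition icol (R : comPzRingType) (K : idl R) (y : R) : idl R :=
  of_ideal (Submodule (colon_closed K y)).

Arguments pri {R} a%_R.
Arguments icol {R} K%_R y%_R.
Arguments idl_mem {R} A : simpl never.
Arguments idl_add {R} A B : simpl never.
Arguments idl_mul {R} A B : simpl never.
Arguments idl_zero {R} : simpl never.
Arguments idl_one {R} : simpl never.

Section IdealLemmas.
Context {R : comPzRingType}.
Implicit Types (A B C K : idl R) (a b x y z : R).

Lemma idl_mem0 A : (0 : R) \in A.
Proof. exact: (@mem_ideal0 _ A). Qed.

Lemma idlD A x y : x \in A -> y \in A -> x + y \in A.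
Proof. exact: (@mem_idealD _ A). Qed.

Lemma idlB A x y : x \in A -> y \in A -> x - y \in A.
Proof. exact: (@mem_idealB _ A). Qed.

Lemma idlMl A x y : y \in A -> x * y \in A.
Proof. exact: (@mem_idealMl _ A). Qed.

Lemma idlMr A x y : x \in A -> x * y \in A.
Proof. by rewrite mulrC; apply: idlMl. Qed.

Lemma of_idealM (I J : ideal R) :
  of_ideal (I * J)%Idl = of_ideal I * of_ideal J.
Proof. by rewrite -[RHS]/(idl_mul _ _) /idl_mul !of_idealK. Qed.

Lemma of_idealD (I J : ideal R) :
  of_ideal (I + J)%Idl = of_ideal I + of_ideal J.
Proof. by rewrite -[RHS]/(idl_add _ _) /idl_add !of_idealK. Qed.

Lemma of_idealX (I : ideal R) n : of_ideal (I ^+ n)%Idl = of_ideal I ^+ n.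
Proof. by elim: n => // n IH; rewrite exprS -IH -of_idealM. Qed.

Lemma idl_ext A B : (forall x : R, (x \in A) = (x \in B)) -> A = B.
Proof.
move=> AB; rewrite -[A]idl_idealK -[B]idl_idealK; congr of_ideal.
by apply: ideal_ext => x; apply: AB.
Qed.

Lemma idl_anti A B : {subset A <= B} -> {subset B <= A} -> A = B.
Proof. by move=> AB BA; apply: idl_ext => x; apply/idP/idP => [/AB|/BA]. Qed.

Lemma idlP A B z :
  reflect (exists x y : R, [/\ x \in A, y \in B & z = x + y]) (z \in A + B).
Proof. exact: (@mem_ideal_add R A B z). Qed.

Lemma priP a A z :
  reflect (exists2 x : R, x \in A & z = a * x) (z \in pri a * A).
Proof.
by rewrite -[_ * _]/(idl_mul _ _) /idl_mul /pri !of_idealK;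
  exact: (@mem_principal_mul R a A z).
Qed.

Lemma memc K y x : (x \in icol K y) = (x * y \in K).
Proof. by []. Qed.

Lemma idl_mul_min A B K :
  (forall x y : R, x \in A -> y \in B -> x * y \in K) ->
  {subset A * B <= K}.
Proof. exact: (@ideal_mul_min R A B K). Qed.

Lemma idl1 x : x \in (1 : idl R).
Proof. exact: mem_ideal_genT. Qed.

Lemma in_idl0 x : (x \in (0 : idl R)) = (x == 0).
Proof. exact: mem_ideal_gen0. Qed.

Lemma idlM A B x y : x \in A -> y \in B -> x * y \in A * B.
Proof. exact: (@mem_ideal_mul R A B x y). Qed.

Lemma idl_eq1 A : (1 : R) \in A -> A = 1.
Proof.
move=> A1; apply: idl_anti => x _; first exact: idl1.
by rewrite -[x]mulr1; apply: idlMl.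
Qed.

Lemma sub_addl A B : {subset A <= A + B}.
Proof. by move=> x xA; apply/idlP; exists x, 0; rewrite idl_mem0 addr0. Qed.

Lemma sub_addr A B : {subset B <= A + B}.
Proof. by rewrite addrC; apply: sub_addl. Qed.

Lemma add_sub A B C :
  {subset A <= C} -> {subset B <= C} -> {subset A + B <= C}.
Proof.
by move=> AC BC _ /idlP[x [y [/AC xC /BC yC ->]]]; apply: idlD.
Qed.

Lemma idl_addS A A' B B' : {subset A <= A'} -> {subset B <= B'} ->
  {subset A + B <= A' + B'}.
Proof.
move=> AA BB; apply: add_sub => x; first by move/AA; apply: sub_addl.
by move/BB; apply: sub_addr.
Qed.

Lemma idl_mulS A A' B B' : {subset A <= A'} -> {subset B <= B'} ->
  {subset A * B <= A' * B'}.
Proof.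
by move=> AA BB; apply: idl_mul_min => x y /AA xA /BB yB; apply: idlM.
Qed.

Lemma idl_mulSr A B C : {subset B <= C} -> {subset A * B <= A * C}.
Proof. exact: idl_mulS. Qed.

Lemma idl_mulSl A B C : {subset B <= C} -> {subset B * A <= C * A}.
Proof. by move=> BC; apply: idl_mulS. Qed.

Lemma sub_mull A B : {subset A * B <= A}.
Proof. by apply: idl_mul_min => x y xA _; apply: idlMr. Qed.

Lemma sub_mulr A B : {subset A * B <= B}.
Proof. by rewrite mulrC; apply: sub_mull. Qed.

Lemma add_subr A B : {subset A <= B} -> A + B = B.
Proof. by move=> AB; apply: idl_anti; [apply: add_sub | apply: sub_addr]. Qed.

Lemma idl_exp_le A n k : (n <= k)%N -> {subset A ^+ k <= A ^+ n}.
Proof. by move=> /subnKC<-; rewrite exprD; apply: sub_mull. Qed.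

Lemma idlX A x n : x \in A -> x ^+ n \in A ^+ n.
Proof.
move=> xA; elim: n => [|n IH]; first exact: idl1.
by rewrite !exprS; apply: idlM.
Qed.

Lemma mem_pri a : a \in pri a.
Proof. exact: (@mem_ideal_gen R [set a]). Qed.

Lemma inpriP a z : reflect (exists x : R, z = a * x) (z \in pri a).
Proof.
rewrite -[pri a]mulr1; apply: (iffP (priP _ _ _)) => [[x _ ->]|[x ->]].
  by exists x.
by exists x => //; apply: idl1.
Qed.

Lemma pri_sub a A : a \in A -> {subset pri a <= A}.
Proof. by move=> aA x /inpriP[r ->]; apply: idlMr. Qed.

Lemma pri1 : pri (1 : R) = 1.
Proof. by apply: idl_eq1; apply: mem_pri. Qed.

Lemma priM a b : pri (a * b) = pri a * pri b.
Proof.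
apply: idl_anti => x.
  by apply: pri_sub; apply: idlM; apply: mem_pri.
move=> /priP[y /inpriP[z ->] ->]; apply/inpriP; exists z; ring.
Qed.

Lemma priX a n : pri (a ^+ n) = pri a ^+ n.
Proof. by elim: n => [|n IH]; rewrite ?expr0 ?pri1 // !exprS priM IH. Qed.

Lemma pri_mulS a A B : a \in B -> {subset pri a * A <= B * A}.
Proof. by move=> aB; apply/idl_mulSl/pri_sub. Qed.

Lemma subc K y : {subset K <= icol K y}.
Proof. by move=> x xK; rewrite memc; apply: idlMr. Qed.

Lemma colS A B y : {subset A <= B} -> {subset icol A y <= icol B y}.
Proof. by move=> AB x; rewrite !memc; apply: AB. Qed.

Lemma col1 K y : y \in K -> icol K y = 1.
Proof. by move=> yK; apply: idl_eq1; rewrite memc mul1r. Qed.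

End IdealLemmas.

#[local] Hint Resolve idl1 mem_pri sub_addl sub_addr sub_mull sub_mulr subc : core.

Section FinGen.
Context {R : comPzRingType}.
Implicit Types (A B : idl R) (s : seq R).

Definition gens s : idl R := \sum_(x <- s) pri x.

Lemma gens_nil : gens [::] = 0.
Proof. exact: big_nil. Qed.

Lemma gens_cons x s : gens (x :: s) = pri x + gens s.
Proof. exact: big_cons. Qed.

Lemma gens_sub s A :
  (forall x, x \in s -> x \in A) -> {subset gens s <= A}.
Proof.
elim: s => [|y s IH] sA x.
  by rewrite gens_nil in_idl0 => /eqP->; exact: idl_mem0.
rewrite gens_cons; apply: add_sub => [{}x|].
  by apply: pri_sub; apply: sA; rewrite mem_head.
by apply: IH => z zs; apply: sA; rewrite inE zs orbT.
Qed.

Lemma mem_gens s x : x \in s -> x \in gens s.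
Proof.
elim: s => // y s IH; rewrite inE gens_cons => /predU1P[->|/IH].
  exact/sub_addl/mem_pri.
exact: sub_addr.
Qed.

Lemma ideal_gen_seq s : of_ideal (ideal_gen [set` s]) = gens s.
Proof.
apply: idl_anti.
  by apply: (@ideal_gen_min R _ (gens s)) => y; apply: mem_gens.
by apply: gens_sub => x xs; apply: (@mem_ideal_gen R [set` s]).
Qed.

End FinGen.

(** * Lengths of quotients *)

Section Colength.
Context {R : comPzRingType}.
Implicit Types (A B K X Y : idl R) (c : R).

(** These correspond to the strict chains of submodules of R / K. Using ideals of [R] keeps one
    ambient object while [K] varies. *)
Definition chain_above K n := exists2 N : nat -> idl R,
  {subset K <= N 0%N} & strict_chain N n.

Definition colfin K := exists b, forall n, chain_above K n -> (n <= b)%N.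

(* The length of R / K, or [0] if it is infinite. *)
Definition colen K : nat := xget 0%N [set l | is_maximum (chain_above K) l].

End Colength.

Arguments colen {R} K%_R.

(* [lia] compares the arguments of [colen] syntactically, which fails when they
   contain the same operation along different inheritance paths. *)
Ltac colen_lia := repeat (match goal with |- context [colen ?K] =>
  let n := fresh "n" in set n := (colen K); clearbody n end); lia.

Section ColengthTheory.
Context {R : comPzRingType}.
Implicit Types (A B K X Y : idl R) (c : R).

Lemma chain_above0 K : chain_above K 0.
Proof. by exists (fun=> K). Qed.

Lemma colenP K : colfin K -> is_maximum (chain_above K) (colen K).
Proof.
move=> [b Kb]; rewrite /colen; case: xgetP => [l -> //|/= noK].
have ex0 : exists n, `[< chain_above K n >].
  by exists 0%N; apply/asboolP/chain_above0.
have bd n : `[< chain_above K n >] -> (n <= b)%N by move/asboolP/Kb.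
case: (ex_maxnP ex0 bd) => l /asboolP Kl lmax; case: (noK l); split=> // k Kk.
exact/lmax/asboolP.
Qed.

Lemma chain_le_colen K n : colfin K -> chain_above K n -> (n <= colen K)%N.
Proof. by move=> /colenP[_]; apply. Qed.

Lemma chain_colen K : colfin K -> chain_above K (colen K).
Proof. by move=> /colenP[]. Qed.

Lemma chain_aboveS K K' n : {subset K <= K'} ->
  chain_above K' n -> chain_above K n.
Proof. by move=> KK [N N0 Ns]; exists N => // x /KK /N0. Qed.

Lemma colfinS K K' : {subset K <= K'} -> colfin K -> colfin K'.
Proof. by move=> KK [b Kb]; exists b => n /(chain_aboveS KK)/Kb. Qed.

Lemma leq_colen K K' : {subset K <= K'} -> colfin K ->
  (colen K' <= colen K)%N.
Proof.
move=> KK Kf; apply: (chain_le_colen Kf); apply: (chain_aboveS KK).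
exact/chain_colen/(colfinS KK).
Qed.

Lemma ltn_colen K K' : {subset K <= K'} -> ~ {subset K' <= K} -> colfin K ->
  (colen K' < colen K)%N.
Proof.
move=> KK nKK Kf; apply: (chain_le_colen Kf).
have [N N0 Ns] := chain_colen (colfinS KK Kf).
exists (fun i => if i is i'.+1 then N i' else K) => // -[_|i]; last exact: Ns.
by split=> [x /KK /N0|N0K] //; apply: nKK => x /N0 /N0K.
Qed.

Lemma colen_inj K K' : {subset K <= K'} -> colfin K ->
  (colen K <= colen K')%N -> K = K'.
Proof.
move=> KK Kf le_KK; apply: idl_anti => //; apply: contrapT => nKK.
by have := ltn_colen KK nKK Kf; rewrite ltnNge le_KK.
Qed.

(** A potential argument: [f] drops by at least one at each step of the chain. *)
Lemma chain_above_bound (f : idl R -> nat) K n :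
  (forall X Y, {subset K <= X} -> {subset X <= Y} -> ~ {subset Y <= X} ->
     (f Y < f X)%N) ->
  (forall X, {subset K <= X} -> (f X <= f K)%N) ->
  chain_above K n -> (n <= f K)%N.
Proof.
move=> fs fK [N KN Ns].
suff H i : (i <= n)%N -> {subset K <= N i} /\ (i + f (N i) <= f K)%N.
  by have [_ /(leq_trans (leq_addr _ _))] := H n (leqnn n).
elim: i => [_|i IH lt_in]; first by split=> //; apply: fK.
have [KNi le_i] := IH (ltnW lt_in); have [sN nsN] := Ns i lt_in.
split=> [x /KNi /sN //|].
by rewrite addSn; apply: leq_trans le_i; rewrite ltn_add2l fs.
Qed.

(** One half of additivity along 0 -> R/(K : c) -> R/K -> R/(K + (c)) -> 0: the chain [Y] is
    transported to [c Y i + K], and [Z] is put on top of it. *)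
Lemma cat_chain K c p q : chain_above (icol K c) p ->
  chain_above (K + pri c) q -> chain_above K (p + q).
Proof.
move=> [Y KY Ys] [Z KZ Zs].
have KYi i : (i <= p)%N -> {subset icol K c <= Y i}.
  elim: i => // i IH lt_ip x /(IH (ltnW lt_ip)).
  by have [+ _] := Ys i lt_ip; apply.
exists (fun i => if (i <= p)%N then pri c * Y i + K else Z (i - p)%N).
  by rewrite leq0n; apply: sub_addr.
move=> i lt_i; case: (ltngtP i p) => [lt_ip|lt_pi|eq_ip].
- have [sY nsY] := Ys i lt_ip; split.
    by apply: idl_addS => //; apply: idl_mulSr.
  move=> H; apply: nsY => y yY.
  have : c * y \in pri c * Y i + K.
    by apply/H/sub_addl/idlM => //; apply: mem_pri.
  move=> /idlP[_ [k [/priP[y' yY' ->] kK /eqP]]].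
  rewrite addrC -subr_eq -mulrBr => /eqP E.
  rewrite -[y](subrK y'); apply: idlD => //.
  by apply: (KYi _ (ltnW lt_ip)); rewrite memc mulrC E.
- by rewrite subSn 1?ltnW //; apply: Zs; rewrite ltn_subLR // ltnW.
(* At the junction [c Y p + K] takes the place of [Z 0], which contains it, so the step to [Z 1]
   stays strict. *)
have q_gt0 : (0 < q)%N by lia.
rewrite {}eq_ip subSnn.
have [sZ nsZ] := Zs 0%N q_gt0.
have sY : {subset pri c * Y p + K <= Z 0%N}.
  move=> x xY; apply: KZ; apply: add_sub xY => [{}x xY|].
    exact/sub_addr/(sub_mull xY).
  exact: sub_addl.
by split=> [x /sY /sZ //|H]; apply: nsZ => x /H /sY.
Qed.

(** A five lemma for the same sequence: an element of [B] is x + c r with x in [A], and then r lies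
    in (B : c), hence in (A : c). It makes the sum of the two outer lengths strictly monotone. *)
Lemma col_add_inj A B c : {subset A <= B} ->
  {subset B + pri c <= A + pri c} -> {subset icol B c <= icol A c} ->
  {subset B <= A}.
Proof.
move=> AB BAc BcA y yB.
have /idlP[x [_ [xA /inpriP[r ->] Ey]]] : y \in A + pri c.
  exact/BAc/sub_addl.
have : r \in icol A c.
  by apply: BcA; rewrite memc mulrC -[c * r](addKr x) -Ey addrC idlB // AB.
by rewrite memc mulrC Ey => rA; apply: idlD.
Qed.

Lemma colen_exact_bound K c n :
  colfin (K + pri c) -> colfin (icol K c) -> chain_above K n ->
  (n <= colen (K + pri c) + colen (icol K c))%N.
Proof.
move=> f1 f2; pose f X := (colen (X + pri c) + colen (icol X c))%N.
have le X Y : {subset K <= X} -> {subset X <= Y} ->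
    (colen (Y + pri c) <= colen (X + pri c))%N /\
    (colen (icol Y c) <= colen (icol X c))%N.
  move=> KX XY; split; apply: leq_colen.
  - exact: idl_addS.
  - by apply: colfinS f1; apply: idl_addS.
  - exact: colS.
  - by apply: colfinS f2; apply: colS.
apply: (@chain_above_bound f) => [X Y KX XY nYX|X KX]; last first.
  by have [] := le _ _ (fun x => id) KX; rewrite /f; lia.
have [le1 le2] := le _ _ KX XY.
have [H|H] := pselect ({subset Y + pri c <= X + pri c}); last first.
  suff : (colen (Y + pri c) < colen (X + pri c))%N by rewrite /f; lia.
  apply: ltn_colen => //; first exact: idl_addS.
  by apply: colfinS f1; apply: idl_addS.
suff : (colen (icol Y c) < colen (icol X c))%N by rewrite /f; lia.
apply: ltn_colen; first exact: colS.
  by move=> H'; apply: nYX; apply: col_add_inj H H'.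
by apply: colfinS f2; apply: colS.
Qed.

Lemma colfin_exact K c : colfin (K + pri c) -> colfin (icol K c) -> colfin K.
Proof.
by move=> f1 f2; eexists=> n; apply: colen_exact_bound f1 f2.
Qed.

Lemma colen_exact K c : colfin K ->
  colen K = (colen (K + pri c) + colen (icol K c))%N.
Proof.
move=> Kf.
have f1 : colfin (K + pri c) by apply: colfinS Kf; apply: sub_addl.
have f2 : colfin (icol K c) by apply: colfinS Kf; apply: subc.
apply/eqP; rewrite eqn_leq (colen_exact_bound f1 f2 (chain_colen Kf)) /=.
apply: (chain_le_colen Kf).
by rewrite addnC; apply: (@cat_chain _ c); apply: chain_colen.
Qed.

Lemma colfin1 : colfin (1 : idl R).
Proof.
exists 0%N => -[//|n] [N N0 /(_ 0%N isT)[_ []]] x _.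
exact/N0/idl1.
Qed.

Lemma colen1 : colen (1 : idl R) = 0%N.
Proof.
have [N N0 Ns] := chain_colen colfin1.
case: (colen 1) Ns => // n /(_ 0%N isT)[_ []] x _; exact/N0/idl1.
Qed.

Lemma colfin_gens K s : colfin (K + gens s) ->
  (forall x, x \in s -> colfin (icol K x)) -> colfin K.
Proof.
elim: s K => [|x s IH] K; first by rewrite gens_nil addr0.
rewrite gens_cons addrA => f1 f2.
apply: (@colfin_exact _ x); last by apply: f2; rewrite mem_head.
apply: IH => // y ys; apply: colfinS (f2 y _); last by rewrite inE ys orbT.
exact/colS/sub_addl.
Qed.

(* Submodularity: the length of (B + P) / B decreases with B. *)
Lemma colen_submod A B s : {subset A <= B} -> colfin A ->
  (colen B + colen (A + gens s) <= colen A + colen (B + gens s))%N.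
Proof.
elim: s A B => [|x s IH] A B AB fA; first by rewrite gens_nil !addr0 addnC.
rewrite gens_cons !addrA.
have fB : colfin B := colfinS AB fA.
have sAB : {subset A + pri x <= B + pri x} by apply: idl_addS.
have := IH _ _ sAB (colfinS (@sub_addl _ A (pri x)) fA).
have := @leq_colen _ _ (colS (y := x) AB) (colfinS (@subc _ A x) fA).
have := colen_exact x fA; have := colen_exact x fB; colen_lia.
Qed.

End ColengthTheory.

(** * Local rings *)

Section PrimeAvoidance.
Context {R : comPzRingType}.
Implicit Types (A K P Q : idl R) (S : set R).

(** [S] is arbitrary here: [S = {1}] yields maximal ideals, a multiplicative [S] yields primes. *)
Lemma max_disjoint K S : (forall x, x \in K -> ~ S x) ->
  exists P, [/\ {subset K <= P}, forall x, x \in P -> ~ S x &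
    forall Q, {subset P <= Q} -> (forall x, x \in Q -> ~ S x) ->
      {subset Q <= P}].
Proof.
move=> KS.
pose T := {X : idl R | {subset K <= X} /\ forall x, x \in X -> ~ S x}.
pose r (X Y : T) := `[< {subset proj1_sig X <= proj1_sig Y} >].
have [//||||[P [KP PS]] Pmax] := @Zorn T r.
- by move=> X; apply/asboolP.
- by move=> X Y Z /asboolP XY /asboolP YZ; apply/asboolP => x /XY /YZ.
- move=> [X pX] [Y pY] /asboolP /= XY /asboolP /= YX.
  have E : X = Y by apply: idl_anti.
  by case: _ / E pY {XY YX} => pY; rewrite (Prop_irrelevance pX pY).
- move=> F Ftot.
  (* [K] is put into the union so that the empty chain has an upper bound as well. *)
  pose U : {pred R^o} := fun x : R =>
    `[< x \in K \/ exists2 X : T, F X & x \in proj1_sig X >].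
  have Uc : submod_closed U.
    split=> [|c x y]; first by apply/asboolP; left; apply: idl_mem0.
    move=> /asboolP Ux /asboolP Uy; apply/asboolP.
    have HK (Z : T) (z : R) : z \in K -> z \in proj1_sig Z.
      by case: Z => Z [KZ _] /= /KZ.
    have sD (Z : idl R) : (x : R) \in Z -> (y : R) \in Z -> c * x + y \in Z.
      by move=> xZ yZ; apply: idlD => //; apply: idlMl.
    case: Ux Uy => [xK|[X FX xX]] [yK|[Y FY yY]].
    - by left; apply: sD.
    - by right; exists Y => //; apply: sD => //; apply: HK.
    - by right; exists X => //; apply: sD => //; apply: HK.
    right; case: (Ftot X Y FX FY) => /asboolP sXY.
      by exists Y => //; apply: sD => //; apply: sXY.
    by exists X => //; apply: sD => //; apply: sXY.
  have US : {subset K <= (Idl Uc : idl R)} /\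
      forall x : R, x \in (Idl Uc : idl R) -> ~ S x.
    split=> [x xK|x /asboolP[/KS //|[[X [KX XS]] _ /XS //]]].
    by apply/asboolP; left.
  exists (exist _ (Idl Uc) US) => X FX; apply/asboolP => x xX.
  by apply/asboolP; right; exists X.
exists P; split=> // Q PQ QS.
have KQ : {subset K <= Q} by move=> x /KP /PQ.
have rPQ : r (exist _ P (conj KP PS)) (exist _ Q (conj KQ QS)).
  exact/asboolP.
by have /(congr1 (fun X => proj1_sig X)) /= <- := Pmax _ rPQ.
Qed.

Lemma prime_disjoint K S :
  S 1 -> (forall x y, S x -> S y -> S (x * y)) ->
  (forall x, x \in K -> ~ S x) ->
  exists P, [/\ {subset K <= P}, forall x, x \in P -> ~ S x &
    forall x y, x * y \in P -> x \in P \/ y \in P].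
Proof.
move=> S1 SM /max_disjoint[P [KP PS Pmax]]; exists P; split=> // x y xyP.
have H z : z \notin P -> exists p r, [/\ p \in P & S (p + z * r)].
  move=> zP; apply: contrapT => nS; case/negP: zP.
  apply: (Pmax (P + pri z)) => [u|_ /idlP[p [_ [pP /inpriP[r ->] ->]]] Sp|].
  - exact: sub_addl.
  - by apply: nS; exists p, r.
  exact/sub_addr/mem_pri.
have [|/H[p [r [pP Sp]]]] := boolP (x \in P); first by left.
have [|/H[q [s [qP Sq]]]] := boolP (y \in P); first by right.
case: (PS _ _ (SM _ _ Sp Sq)).
have -> : (p + x * r) * (q + y * s) =
    (q + y * s) * p + (x * r) * q + (r * s) * (x * y) by ring.
by apply: idlD; [apply: idlD|]; apply: idlMl.
Qed.

End PrimeAvoidance.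

Record noeth_local (R : comPzRingType) (m : idl R) : Prop := NoethLocal {
  local_proper : (1 : R) \notin m;
  local_unit : forall x : R, x \notin m -> exists y, x * y = 1;
  local_noeth : forall A : idl R, exists s, A = gens s
}.

Section NoethLocalTheory.
Context {R : comPzRingType} {m : idl R} (Rm : noeth_local m).
Implicit Types (A B C K X Y : idl R) (a b x y z t : R) (s ts : seq R).

Lemma unit_mem x A : x \notin m -> forall y, x * y \in A -> y \in A.
Proof.
move=> /(local_unit Rm)[z xz1] y xyA.
by rewrite -[y]mul1r -xz1 (mulrC x) -mulrA; apply: idlMl.
Qed.

Lemma local_prime x y : x * y \in m -> x \notin m -> y \in m.
Proof. by move=> xym xm; apply: unit_mem xym. Qed.

Lemma sub_or_eq1 A : {subset A <= m} \/ A = 1.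
Proof.
have [|nAm] := pselect ({subset A <= m}); first by left.
right; have [x xA xm] : exists2 x, x \in A & x \notin m.
  apply: contrapT => H; apply: nAm => x xA; apply: contrapT => /negP xm.
  by apply: H; exists x.
by apply: idl_eq1; apply: (unit_mem xm); rewrite mulr1.
Qed.

(** Generators are removed one at a time: modulo [B] and the remaining generators, [g] equals [r g]
    for some [r] in [m], and [1 - r] is a unit. *)
Lemma gens_nakayama A B s :
  {subset A <= B + gens s} -> {subset B + gens s <= A} ->
  {subset A <= B + m * A} -> {subset A <= B}.
Proof.
elim: s => [|g s IH]; first by rewrite gens_nil addr0.
rewrite gens_cons => sA As AB.
have gA : g \in A by apply/As/sub_addr/sub_addl/mem_pri.
apply: IH (AB); last first.
  by move=> x /idlP[u [v [uB vs ->]]]; apply/As/idlP; exists u, v;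
    split=> //; apply: sub_addr.
suff gs : g \in B + gens s.
  move=> x /sA; rewrite addrCA; apply: add_sub x => //.
  exact: pri_sub.
have : g \in B + gens s + m * pri g.
  have /AB : g \in A by [].
  apply: add_sub => [x xB|]; first exact/sub_addl/sub_addl.
  move=> x /(idl_mulSr sA); rewrite !mulrDr addrCA => H.
  rewrite addrC; apply: idl_addS H => // {}x.
  by apply: idl_addS => //; apply: sub_mulr.
move=> /idlP[u [y [us]]]; rewrite mulrC => /priP[r rm ->] E.
have r1 : 1 - r \notin m.
  apply: contra (local_proper Rm) => H; rewrite -[1](subrK r).
  exact: idlD.
apply: (unit_mem r1).
have -> : (1 - r) * g = u by rewrite mulrBl mul1r {1}E; ring.
by [].
Qed.

Lemma nakayama A B : {subset A <= B + m * A} -> {subset A <= B}.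
Proof.
move=> AB; have [s E] := local_noeth Rm A.
suff H : {subset A + B <= B} by move=> x xA; apply/H/sub_addl.
apply: (@gens_nakayama _ _ s); rewrite -?E; rewrite addrC //.
apply: add_sub => [|x /AB]; first exact: sub_addl.
by apply: idl_addS => //; apply: idl_mulSr; apply: sub_addr.
Qed.

(** The unit ideal is included, so that colon ideals and powers with exponent [0] need no case
    distinction. *)
Definition mprim K := exists n, {subset m ^+ n <= K}.

Lemma mprimS A B : {subset A <= B} -> mprim A -> mprim B.
Proof. by move=> AB [n nA]; exists n => x /nA /AB. Qed.

Lemma mprimM A B : mprim A -> mprim B -> mprim (A * B).
Proof.
by move=> [i iA] [j jB]; exists (i + j)%N; rewrite exprD; apply: idl_mulS.
Qed.

Lemma mprim1 : mprim 1.
Proof. by exists 0%N. Qed.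

Lemma mprimX A n : mprim A -> mprim (A ^+ n).
Proof.
move=> mA; elim: n => [|n IH]; first exact: mprim1.
by rewrite exprS; apply: mprimM.
Qed.

Lemma mprim_m : mprim m.
Proof. by exists 1%N; rewrite expr1. Qed.

Lemma mprimDl A B : mprim A -> mprim (A + B).
Proof. by apply: mprimS; apply: sub_addl. Qed.

Lemma mprimC A x : mprim A -> mprim (icol A x).
Proof. by apply: mprimS; apply: subc. Qed.

Lemma colen_m_chain K n : {subset m <= K} -> chain_above K n -> (n <= 1)%N.
Proof.
move=> mK [N KN Ns]; rewrite leqNgt; apply/negP => n2.
have [s0 ns0] := Ns 0%N (ltnW n2); have [s1 ns1] := Ns 1%N n2.
have [N1|N1] := sub_or_eq1 (N 1%N).
  by apply: ns0 => x /N1 /mK /KN.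
by apply: ns1; rewrite N1 => x _; apply: idl1.
Qed.

Lemma colfin_m K : {subset m <= K} -> colfin K.
Proof. by move=> mK; exists 1%N => n; apply: colen_m_chain. Qed.

Lemma colen_m_le K : {subset m <= K} -> (colen K <= 1)%N.
Proof.
by move=> mK; apply: (colen_m_chain mK); apply/chain_colen/colfin_m.
Qed.

(** For each generator [x] of m^n, the colon (m^(n+1) : x) contains [m]; so passing from m^n to
    m^(n+1) adds at most one to the length per generator. *)
Lemma mprim_colfin K : mprim K -> colfin K.
Proof.
move=> [n /colfinS]; apply; elim: n => [|n IH]; first exact: colfin1.
have [s E] := local_noeth Rm (m ^+ n).
apply: (@colfin_gens _ _ s) => [|x xs].
  by apply: colfinS IH; rewrite -E; apply: sub_addr.
apply: colfin_m => y ym; rewrite memc exprS; apply: idlM => //.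
by rewrite E; apply: mem_gens.
Qed.

Lemma leq_colen_prim A B : {subset A <= B} -> mprim A ->
  (colen B <= colen A)%N.
Proof. by move=> AB /mprim_colfin; apply: leq_colen. Qed.

Lemma colen_submod_idl A B K : {subset A <= B} -> mprim A ->
  (colen B + colen (A + K) <= colen A + colen (B + K))%N.
Proof.
move=> AB /mprim_colfin fA; have [s ->] := local_noeth Rm K.
exact: colen_submod.
Qed.

End NoethLocalTheory.

Arguments mprim {R} m K%_R.

(** * Genericity over the residue field *)

Section ModResidue.
Context {R : comNzRingType} {m : idl R} (Rm : noeth_local m).
Implicit Types (A B C K X Y I J : idl R) (a b x y z t : R) (s ts : seq R).
Implicit Types (P Q : R -> Prop).

Definition distinct_mod ts := pairwise (fun x y : R => x - y \notin m) ts.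

(** Roots are split off over [R] itself, up to an error in [m]; differences of incongruent roots are
    units, so the argument for fields applies. *)
Lemma poly_roots_mod (p : {poly R}) ts :
  distinct_mod ts -> (forall t, t \in ts -> p.[t] \in m) ->
  (size p <= size ts)%N -> forall u, p.[u] \in m.
Proof.
elim: ts p => [|t ts IH] p.
  by move=> _ _; rewrite leqn0 size_poly_eq0 => /eqP-> u;
    rewrite horner0 idl_mem0.
rewrite /distinct_mod pairwise_cons => /andP[/allP tts dts] pts sp u.
have /factor_theorem[q Eq] : root (p - p.[t]%:P) t.
  by rewrite rootE hornerD hornerN hornerC subrr.
have Ep v : p.[v] = q.[v] * (v - t) + p.[t].
  by rewrite -[p in LHS](subrK p.[t]%:P) Eq hornerD hornerM hornerC hornerXsubC.
rewrite Ep; apply: idlD; last by apply: pts; rewrite mem_head.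
apply/idlMr/(IH q) => // [v vts|].
  apply: (@local_prime _ _ Rm (t - v)); last exact: tts.
  have -> : (t - v) * q.[v] = p.[t] - p.[v] by rewrite [p.[v]]Ep; ring.
  by apply: idlB; apply: pts; rewrite ?mem_head // inE vts orbT.
have [->|q0] := eqVneq q 0; first by rewrite size_poly0.
have Esz : size (p - p.[t]%:P) = (size q).+1.
  by rewrite Eq size_Mmonic ?monicXsubC // size_XsubC addn2.
have : (size (p - p.[t]%:P)%R <= maxn (size p) 1)%N.
  apply: leq_trans (size_polyD _ _) _.
  by rewrite size_polyN geq_max leq_maxl /= leq_max size_polyC_leq1 orbT.
rewrite -size_poly_gt0 in q0.
rewrite Esz leq_max => /orP[lt_qp|]; last by rewrite ltnNge q0.
by rewrite -ltnS; apply: leq_trans lt_qp sp.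
Qed.

(** Plays the role of a nonempty open subset of the affine line over the residue field, although
    [P t] may depend on more than the class of [t] modulo [m]. *)
Definition cofin P := exists n, forall ts, distinct_mod ts ->
  (forall t, t \in ts -> ~ P t) -> (size ts <= n)%N.

Lemma cofinS P Q : (forall t, P t -> Q t) -> cofin P -> cofin Q.
Proof.
by move=> PQ [n nP]; exists n => ts dts Qts; apply: nP => // t /Qts nQ /PQ.
Qed.

Lemma cofinI P Q : cofin P -> cofin Q -> cofin (fun t => P t /\ Q t).
Proof.
move=> [n nP] [k kQ]; exists (n + k)%N => ts dts PQts.
rewrite -(count_predC (fun t => ~~ `[< P t >]) ts) leq_add //.
  rewrite -size_filter; apply: nP => [|t]; first exact: pairwise_filter.
  by rewrite mem_filter => /andP[/negP nPt _] /asboolP.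
rewrite -size_filter; apply: kQ => [|t]; first exact: pairwise_filter.
rewrite mem_filter /= negbK => /andP[/asboolP Pt tts] Qt.
exact: (PQts t).
Qed.

Lemma cofin_shift P c : cofin P -> cofin (fun t => P (t + c)).
Proof.
move=> [n nP]; exists n => ts dts Pts; rewrite -(size_map (+%R^~ c)).
apply: nP => [|_ /mapP[t tts ->]]; last exact: Pts.
rewrite /distinct_mod pairwise_map.
by apply: sub_pairwise dts => x y /=; rewrite opprD addrACA subrr addr0.
Qed.

(** Cramer's rule: multiply the system by the adjugate of [M]. *)
Lemma cramer_mem k (M : 'M[R]_k) (g : 'I_k -> R) B :
  (forall i, \sum_j M i j * g j \in B) -> forall j, \det M * g j \in B.
Proof.
move=> MB j.
have -> : \det M * g j = \sum_i (\adj M) j i * (\sum_l M i l * g l).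
  transitivity (\sum_l (\adj M *m M) j l * g l).
    rewrite mul_adj_mx (bigD1 j) //= mxE eqxx mulr1n big1 ?addr0 // => l lj.
    by rewrite mxE eq_sym (negbTE lj) mulr0n mul0r.
  transitivity (\sum_l \sum_i (\adj M) j i * M i l * g l).
    by apply: eq_bigr => l _; rewrite mxE mulr_suml.
  rewrite exchange_big; apply: eq_bigr => i _ /=.
  by rewrite mulr_sumr; apply: eq_bigr => l _; rewrite mulrA.
elim/big_ind: _ => [|x y xB yB|i _]; first exact: idl_mem0.
  exact: idlD.
exact: idlMl.
Qed.

Lemma gens_coords s x : x \in gens s ->
  exists c : 'I_(size s) -> R, x = \sum_i c i * s`_i.
Proof.
elim: s x => [|y s IH] x.
  rewrite gens_nil in_idl0 => /eqP->; exists (fun=> 0); by rewrite big_ord0.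
rewrite gens_cons => /idlP[_ [z [/inpriP[r ->] /IH[c ->] ->]]].
exists (fun i => if unlift ord0 i is Some j then c j else r).
rewrite big_ord_recl unlift_none /= mulrC; congr (_ + _).
by apply: eq_bigr => i _; rewrite liftK.
Qed.

(* [g + t v = (1 + t M) g] with [det (1 + t M)] a polynomial in [t] that is
   [1] at [t = 0], hence a unit for almost all [t] modulo [m]. *)
Lemma cofin_gens s (v : 'I_(size s) -> R) :
  (forall i, v i \in gens s) ->
  cofin (fun t => forall C, (forall i : 'I_(size s), s`_i + t * v i \in C) ->
    {subset gens s <= C}).
Proof.
move=> vs; have [M vM] := choice (fun i => gens_coords (vs i)).
pose A : 'M[R]_(size s) := \matrix_(i, j) M i j.
pose p := \det (1%:M + 'X *: map_mx polyC A).
have pE t : p.[t] = \det (1%:M + t *: A).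
  rewrite /p -[LHS]/(horner_eval t _) -det_map_mx; congr (\det _).
  apply/matrixP => i j; rewrite !mxE.
  rewrite -[LHS]/(((i == j)%:R + 'X * (M i j)%:P).[t]).
  by rewrite hornerD hornerM hornerX hornerC hornerMn hornerC.
exists (size p) => ts dts bad; rewrite leqNgt; apply/negP => lt_p.
have pm t : t \in ts -> p.[t] \in m.
  move=> tts; apply: contrapT => /negP ptm; apply: (bad t tts) => C gC.
  apply: gens_sub => _ /(nthP 0)[i lt_i <-].
  apply: (unit_mem Rm ptm); rewrite pE.
  apply: (@cramer_mem _ _ (fun j : 'I_(size s) => s`_j) _ _ (Ordinal lt_i)) => k.
  have -> : \sum_j (1%:M + t *: A) k j * s`_j = s`_k + t * v k.
    rewrite vM mulr_sumr.
    transitivity (\sum_j ((k == j)%:R * s`_j + t * (M k j * s`_j))).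
      by apply: eq_bigr => j _; rewrite !mxE mulrDl mulrA.
    rewrite big_split /=; congr (_ + _).
    rewrite (bigD1 k) //= eqxx mul1r big1 ?addr0 // => j jk.
    by rewrite eq_sym (negbTE jk) mul0r.
  exact: gC.
have := poly_roots_mod dts pm (ltnW lt_p) 0.
by rewrite pE scale0r addr0 det1 (negbTE (local_proper Rm)).
Qed.

(** Write each generator of [A] as b + x s1 + y s2. The perturbation x' s1 + y' s2 lies in [A]
    again, so [cofin_gens] shows that the perturbed generators still generate [A] for almost all
    [t]. *)
Lemma open_sub A B S1 S2 x y x' y' :
  {subset A <= B + pri x * S1 + pri y * S2} ->
  {subset pri x' * S1 + pri y' * S2 <= A} ->
  cofin (fun t =>
    {subset A <= B + pri (x + t * x') * S1 + pri (y + t * y') * S2}).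
Proof.
move=> sA As; have [s E] := local_noeth Rm A.
have H (i : 'I_(size s)) : exists w : R * R * R,
    [/\ w.1.1 \in B, w.1.2 \in S1, w.2 \in S2 &
        s`_i = w.1.1 + x * w.1.2 + y * w.2].
  have /sA/idlP[u [z [+ /priP[s2 s2S ->] ->]]] : s`_i \in A.
    by rewrite E; apply: mem_gens; rewrite mem_nth.
  move=> /idlP[b [z' [bB /priP[s1 s1S ->] ->]]].
  by exists (b, s1, s2).
have {H}[w wP] := choice H.
have vs i : x' * (w i).1.2 + y' * (w i).2 \in gens s.
  rewrite -E; apply: As; have [_ s1S s2S _] := wP i.
  apply/idlP; exists (x' * (w i).1.2), (y' * (w i).2).
  by split=> //; apply/priP; [exists (w i).1.2 | exists (w i).2].
apply: cofinS (cofin_gens vs) => t; rewrite E; apply=> i.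
have [bB s1S s2S ->] := wP i.
have -> : (w i).1.1 + x * (w i).1.2 + y * (w i).2 +
    t * (x' * (w i).1.2 + y' * (w i).2) =
    (w i).1.1 + (x + t * x') * (w i).1.2 + (y + t * y') * (w i).2 by ring.
apply: idlD; last by apply: sub_addr; apply/priP; exists (w i).2.
apply: sub_addl; apply: idlD; first exact: sub_addl.
by apply: sub_addr; apply/priP; exists (w i).1.2.
Qed.

Context (Rinf : forall n, exists2 ts, distinct_mod ts & size ts = n).

Lemma cofin_ex P : cofin P -> exists t, P t.
Proof.
move=> [n nP]; have [ts dts sz] := Rinf n.+1.
apply: contrapT => nex; have := nP ts dts; rewrite sz ltnn => H.
by have /H : forall t, t \in ts -> ~ P t by move=> t _ Pt; apply: nex; exists t.
Qed.

Definition line_open I J (P : R -> R -> Prop) := forall x y x' y',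
  x \in I -> y \in J -> x' \in I -> y' \in J -> P x y ->
  cofin (fun t => P (x + t * x') (y + t * y')).

Definition inhabited_in I J (P : R -> R -> Prop) :=
  exists x y, [/\ x \in I, y \in J & P x y].

Lemma line_openI I J (P Q : R -> R -> Prop) : line_open I J P -> line_open I J Q ->
  line_open I J (fun x y => P x y /\ Q x y).
Proof.
move=> oP oQ x y x' y' xI yJ xI' yJ' [Pxy Qxy].
by apply: cofinI; [apply: oP | apply: oQ].
Qed.

(** On the line joining the two points, [P] holds at the parameter 0 and [Q] at 1; hence both hold
    for almost all parameters. *)
Lemma line_open_meet I J (P Q : R -> R -> Prop) : line_open I J P -> line_open I J Q ->
  inhabited_in I J P -> inhabited_in I J Q ->
  inhabited_in I J (fun x y => P x y /\ Q x y).
Proof.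
move=> oP oQ [x [y [xI yJ Pxy]]] [x' [y' [xI' yJ' Qxy]]].
have xxI := idlB xI' xI; have yyJ := idlB yJ' yJ.
have cP := oP _ _ _ _ xI yJ xxI yyJ Pxy.
have := oQ _ _ _ _ xI' yJ' xxI yyJ Qxy.
move=> /(cofin_shift (- 1))/(cofinI cP)/cofin_ex[t [Pt Qt]].
exists (x + t * (x' - x)), (y + t * (y' - y)).
split; first exact/idlD/idlMl.
  exact/idlD/idlMl.
split=> //.
have [-> ->] : x + t * (x' - x) = x' + (t - 1) * (x' - x) /\
  y + t * (y' - y) = y' + (t - 1) * (y' - y) by split; ring.
exact: Qt.
Qed.

Lemma line_open_all I J (T : eqType) (s : seq T) (P : T -> R -> R -> Prop) :
  (forall i, i \in s -> line_open I J (P i) /\ inhabited_in I J (P i)) ->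
  inhabited_in I J (fun x y => forall i, i \in s -> P i x y).
Proof.
move=> sP; suff [] : line_open I J (fun x y => forall i, i \in s -> P i x y) /\
  inhabited_in I J (fun x y => forall i, i \in s -> P i x y) by [].
elim: s sP => [|i s IH] sP.
  split; last by exists 0, 0; rewrite !idl_mem0.
  by move=> *; exists 0%N => -[|t ts] // _ H; case: (H t); rewrite ?mem_head.
have [oi ni] := sP i (mem_head _ _).
have [os ns] : line_open I J (fun x y => forall i, i \in s -> P i x y) /\
    inhabited_in I J (fun x y => forall i, i \in s -> P i x y).
  by apply: IH => j js; apply: sP; rewrite inE js orbT.
have imp x y : P i x y /\ (forall j, j \in s -> P j x y) ->
    forall j, j \in i :: s -> P j x y.
  by move=> [Pi Ps] j; rewrite inE => /predU1P[->|/Ps].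
split.
  move=> x y x' y' xI yJ xI' yJ' Pxy.
  apply: cofinS (fun t => imp _ _) _.
  apply: (line_openI oi os) => //; split=> [|j js]; first by apply/Pxy/mem_head.
  by apply: Pxy; rewrite inE js orbT.
have [x [y [xI yJ Pxy]]] := line_open_meet oi os ni ns.
by exists x, y; split=> //; apply: imp.
Qed.

End ModResidue.

(** * Existence of joint reductions *)

Section JointEakinSathaye.
Context {R : comNzRingType} {m : idl R} (Rm : noeth_local m).
Context (Rinf : forall n, exists2 ts : seq R, distinct_mod (m := m) ts &
  size ts = n).
Implicit Types (A B C K X Y I J : idl R) (x y : R).

(** The power with exponent [r - 1]. Its value [0] at [r = 0] removes the corresponding term of a
    cover, as the base cases of the two inductions require. *)
Definition prevX I r : idl R := if r is r'.+1 then I ^+ r' else 0.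

Lemma pri_prevX g I r : g \in I -> {subset pri g * prevX I r <= I ^+ r}.
Proof.
case: r => [|r] gI /=; first by rewrite mulr0 => x; rewrite in_idl0 => /eqP->;
  apply: idl_mem0.
by rewrite exprS; apply: pri_mulS.
Qed.

Definition covers A B S1 S2 x y :=
  {subset A <= B + pri x * S1 + pri y * S2}.

Lemma covers_open I J A B S1 S2 :
  {subset I * S1 <= A} -> {subset J * S2 <= A} ->
  line_open (m := m) I J (covers A B S1 S2).
Proof.
move=> IA JA x y x' y' _ _ xI yJ; rewrite /covers => H.
apply: (open_sub Rm H).
by apply: add_sub => z; [move/(pri_mulS xI)/IA | move/(pri_mulS yJ)/JA].
Qed.

Lemma mul_gens_sub A C s :
  (forall g, g \in s -> {subset pri g * A <= C}) -> {subset gens s * A <= C}.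
Proof.
elim: s => [|g s IH] H; first by rewrite gens_nil mul0r => x;
  rewrite in_idl0 => /eqP->; apply: idl_mem0.
rewrite gens_cons mulrDl; apply: add_sub; first by apply: H; rewrite mem_head.
by apply: IH => h hs; apply: H; rewrite inE hs orbT.
Qed.

Lemma idl0_sub A : {subset (0 : idl R) <= A}.
Proof. by move=> x; rewrite in_idl0 => /eqP->; apply: idl_mem0. Qed.

(* Either [g X J^s] covers [X J^(s+1)] for some generator [g] of [J], or for each
   [g] the ideal [g X J^s] satisfies the hypothesis for [s], so it is covered by
   [y g X J^(s-1)] for generic [y]; then [y X J^s] covers [X J^(s+1)]. *)
Lemma eakin_sathaye1 I J s X B : mprim m B ->
  (colen B <= colen (B + X * J ^+ s) + s)%N ->
  inhabited_in I J (covers (X * J ^+ s) B 0 (X * prevX J s)).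
Proof.
move=> mB; elim: s X => [|s IH] X le_s.
  rewrite addn0 in le_s.
  exists 0, 0; split; try exact: idl_mem0.
  have E : B = B + X * J ^+ 0.
    apply: colen_inj le_s; first exact: sub_addl.
    exact: mprim_colfin mB.
  by move=> x xX; apply/sub_addl/sub_addl; rewrite E; apply: sub_addr.
have [gs EJ] := local_noeth Rm J.
have gJ g : g \in gs -> g \in J by rewrite EJ; apply: mem_gens.
set T := X * J ^+ s.+1.
have [[g ggs gT]|nT] :=
  pselect (exists2 g, g \in gs & {subset T <= B + pri g * (X * J ^+ s)}).
  exists 0, g; split; [exact: idl_mem0|exact: gJ|].
  by rewrite /covers mulr0 addr0.
pose P g := covers (pri g * X * J ^+ s) B 0 (pri g * X * prevX J s).
have gsub g : g \in gs -> {subset pri g * X * J ^+ s <= T}.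
  move=> /gJ gJ'; have -> : pri g * X * J ^+ s = pri g * (X * J ^+ s) by ring.
  have -> : T = J * (X * J ^+ s) by rewrite /T exprS; ring.
  exact: pri_mulS.
have [|x [y [xI yJ Pxy]]] := @line_open_all _ _ Rinf I J _ gs P.
  move=> g ggs; split.
    apply: covers_open => [|z]; first by rewrite mulr0; apply: idl0_sub.
    have -> : J * (pri g * X * prevX J s) = pri g * X * (J * prevX J s) by ring.
    apply: idl_mulSr => {}z; case: s {IH le_s T nT P gsub} => [|s] /=.
      by rewrite mulr0; apply: idl0_sub.
    by rewrite exprS.
  apply: IH; set Bg := B + _.
  suff : (colen (B + T) < colen Bg)%N.
    by move: le_s; rewrite -/T; colen_lia.
  apply: ltn_colen; first by apply: idl_addS => //; apply: gsub.
    move=> TB; apply: nT; exists g => // z zT.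
    by rewrite mulrA; apply/TB/sub_addr.
  by apply: (mprim_colfin Rm); apply: mprimDl.
exists x, y; split=> //.
have -> : T = gens gs * (X * J ^+ s) by rewrite /T exprS -EJ; ring.
rewrite /covers /= mulr0 addr0.
apply: mul_gens_sub => g ggs z; rewrite mulrA => /(Pxy g ggs).
rewrite mulr0 addr0; apply: idl_addS => // {}z; apply: idl_mulSr => {}z.
have -> : pri g * X * prevX J s = X * (pri g * prevX J s) by ring.
by apply/idl_mulSr/pri_prevX/gJ.
Qed.

(** Induction on [r]. In the step to [r + 1], either some generator [g] of [I] is good enough for
    [eakin_sathaye1] modulo [Bg g] to finish with [x = g]. Or each [g] accounts for at least [s + 1]
    of the available (r + 2)(s + 1) units of length, so the induction hypothesis applies to [g X],
    and a generic pair serves all [g] at once. *)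
Lemma eakin_sathaye2 I J r s X B : mprim m B ->
  (colen B < colen (B + X * I ^+ r * J ^+ s) + r.+1 * s.+1)%N ->
  inhabited_in I J (covers (X * I ^+ r * J ^+ s) B
    (X * prevX I r * J ^+ s) (X * I ^+ r * prevX J s)).
Proof.
move=> mB; elim: r X => [|r IH] X lt_s.
  rewrite mul1n addnS ltnS expr0 mulr1 in lt_s.
  have [x [y [xI yJ Pxy]]] := eakin_sathaye1 I mB lt_s.
  by exists x, y; rewrite /= mulr0 mul0r expr0 mulr1.
have [gs EI] := local_noeth Rm I.
have gI g : g \in gs -> g \in I by rewrite EI; apply: mem_gens.
set T := X * I ^+ r.+1 * J ^+ s.
pose Bg g := B + pri g * (X * I ^+ r * J ^+ s).
have gsub g : g \in gs -> {subset pri g * (X * I ^+ r * J ^+ s) <= T}.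
  have -> : T = I * (X * I ^+ r * J ^+ s) by rewrite /T exprS; ring.
  by move=> /gI; apply: pri_mulS.
have [[g ggs le_g]|nT] :=
  pselect (exists2 g, g \in gs & (colen (Bg g) <= colen (Bg g + T) + s)%N).
  have [x [y [xI yJ Pxy]]] := eakin_sathaye1 I (mprimDl _ mB) le_g.
  exists g, y; split=> //; first exact: gI.
  by move=> z /Pxy; rewrite mulr0 addr0.
pose P g := covers (pri g * X * I ^+ r * J ^+ s) B
  (pri g * X * prevX I r * J ^+ s) (pri g * X * I ^+ r * prevX J s).
have prev_sub K n : {subset K * prevX K n <= K ^+ n}.
  by case: n => [|n] /=; rewrite ?mulr0 ?exprS //; apply: idl0_sub.
have [|x [y [xI yJ Pxy]]] := @line_open_all _ _ Rinf I J _ gs P.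
  move=> g ggs; split.
    apply: covers_open => z.
      have -> : I * (pri g * X * prevX I r * J ^+ s) =
        pri g * X * (I * prevX I r) * J ^+ s by ring.
      by apply: idl_mulSl => {}z; apply: idl_mulSr => {}z; apply: prev_sub.
    have -> : J * (pri g * X * I ^+ r * prevX J s) =
      pri g * X * I ^+ r * (J * prevX J s) by ring.
    by apply: idl_mulSr => {}z; apply: prev_sub.
  apply: IH.
  have -> : pri g * X * I ^+ r * J ^+ s = pri g * (X * I ^+ r * J ^+ s) by ring.
  have : (colen (Bg g + T) + s < colen (Bg g))%N.
    by rewrite ltnNge; apply/negP => H; apply: nT; exists g.
  have -> : Bg g + T = B + T.
    by rewrite /Bg -addrA (add_subr (gsub g ggs)).
  move: lt_s; rewrite -/T -/(Bg g) [r.+2]lock mulSn -lock mulSn.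
  colen_lia.
exists x, y; split=> //.
have -> : T = gens gs * (X * I ^+ r * J ^+ s) by rewrite /T exprS -EI; ring.
apply: mul_gens_sub => g ggs z.
have -> : pri g * (X * I ^+ r * J ^+ s) = pri g * X * I ^+ r * J ^+ s by ring.
move=> /(Pxy g ggs) /=.
apply: idl_addS => {}z.
  apply: idl_addS => // {}z; apply: idl_mulSr => {}z.
  have -> : pri g * X * prevX I r * J ^+ s =
    X * (pri g * prevX I r) * J ^+ s by ring.
  by apply: idl_mulSl => {}z; apply: idl_mulSr => {}z; apply/pri_prevX/gI.
apply: idl_mulSr => {}z; rewrite exprS.
have -> : pri g * X * I ^+ r * prevX J s = X * (pri g * I ^+ r) * prevX J s.
  by ring.
by apply: idl_mulSl => {}z; apply: idl_mulSr => {}z; apply/pri_mulS/gI.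
Qed.

End JointEakinSathaye.

(** * Regular pairs *)

Section RegularPairs.
Context {R : comPzRingType}.
Implicit Types (A B K : idl R) (a b x y z p q t : R).

Definition nzd a := forall z, a * z = 0 -> z = 0.

(** That is, [b] is a non-zero-divisor on R / (a). *)
Definition regmod a b := forall p q, a * p = b * q -> exists t, q = a * t.

(** Requiring both elements to be regular makes the notion symmetric over any commutative ring. *)
Definition regpair a b := [/\ nzd a, nzd b & regmod a b].

Lemma nzd_inj a x y : nzd a -> a * x = a * y -> x = y.
Proof.
by move=> na E; apply/subr0_eq/na; rewrite mulrBr E subrr.
Qed.

Lemma nzdM a b : nzd a -> nzd b -> nzd (a * b).
Proof. by move=> na nb z; rewrite -mulrA => /na /nb. Qed.

Lemma nzdX a n : nzd a -> nzd (a ^+ n).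
Proof.
move=> na; elim: n => [z|n IH]; first by rewrite mul1r.
by rewrite exprS; apply: nzdM.
Qed.

Lemma regpair_sym a b : regpair a b -> regpair b a.
Proof.
move=> [na nb rab]; split=> // p q E.
have [t Ep] := rab _ _ (esym E); exists t.
by apply: (nzd_inj na); rewrite -E Ep; ring.
Qed.

Lemma regpairM a a' b : regpair a b -> regpair a' b -> regpair (a * a') b.
Proof.
move=> [na nb rab] [na' _ rab']; split=> //; first exact: nzdM.
move=> p q; rewrite -mulrA => E.
have [t Eq] := rab _ _ E.
have [u Et] : exists u, t = a' * u.
  by apply: (rab' p); apply: (nzd_inj na); rewrite E Eq; ring.
by exists u; rewrite Eq Et mulrA.
Qed.

Lemma regpairXl a b n : regpair a b -> regpair (a ^+ n) b.
Proof.
move=> ab; have [na nb _] := ab; elim: n => [|n IH].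
  by split=> // [z|p q _]; rewrite ?mul1r //; exists q; rewrite mul1r.
by rewrite exprS; apply: regpairM.
Qed.

Lemma regpairX a b n k : regpair a b -> regpair (a ^+ n) (b ^+ k).
Proof. by move=> /(regpairXl n)/regpair_sym/(regpairXl k)/regpair_sym. Qed.

Lemma icolDM a b B : regmod a b -> nzd b ->
  icol (pri a + pri b * B) b = pri a + B.
Proof.
move=> rab nb; apply: idl_anti => z; rewrite memc.
  move=> /idlP[u [v [/inpriP[p ->] /priP[w wB ->] E]]].
  have [|t Et] := rab p (z - w).
    by rewrite mulrBr [b * z]mulrC E addrK.
  by apply/idlP; exists (a * t), w; split=> //;
    [apply/inpriP; exists t | rewrite -Et subrK].
move=> /idlP[u [v [/inpriP[p ->] vB ->]]].
apply/idlP; exists (a * (p * b)), (b * v); split.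
- by apply/inpriP; exists (p * b).
- by apply/priP; exists v.
by ring.
Qed.

Lemma icolM b A B : nzd b -> icol (A + pri b * B) b = icol A b + B.
Proof.
move=> nb; apply: idl_anti => z; rewrite memc.
  move=> /idlP[u [v [uA /priP[w wB ->] E]]].
  apply/idlP; exists (z - w), w; rewrite subrK; split=> //.
  by rewrite memc mulrBl E [w * b]mulrC addrK.
move=> /idlP[u [v [+ vB ->]]]; rewrite memc => uA.
apply/idlP; exists (u * b), (b * v); split=> //; last by ring.
by apply/priP; exists v.
Qed.

Lemma icol_joint a b A B : regpair a b ->
  icol (pri a * A + pri b * B) a = A + pri b * icol B a.
Proof.
move=> [na nb rab]; apply: idl_anti => z; rewrite memc.
  move=> /idlP[u [v [/priP[x xA ->] /priP[y yB ->] E]]].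
  have E1 : a * (z - x) = b * y by rewrite mulrBr [a * z]mulrC E; ring.
  have [t Et] := rab _ _ E1.
  apply/idlP; exists x, (b * t); split=> //.
    by apply/priP; exists t; rewrite // memc mulrC -Et.
  apply: (nzd_inj na); move: E1; rewrite Et mulrBr => /eqP.
  by rewrite subr_eq => /eqP->; ring.
move=> /idlP[u [v [uA /priP[t + ->] ->]]]; rewrite memc => tB.
apply/idlP; exists (a * u), (b * (t * a)); split; last by ring.
  by apply/priP; exists u.
by apply/priP; exists (t * a).
Qed.

(* Expresses the relation [(p, q)] as a multiple of the Koszul one: with
   [h = alpha q - beta p], one has [a h = q X] and [b h = - p X], and [Y h] is
   a multiple of [X]. *)
Lemma koszul_syzygy a b X Y :
  nzd X -> regmod X Y -> X \in pri a + pri b -> Y \in pri a + pri b ->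
  forall p q, a * p + b * q = 0 -> exists t, q = a * t /\ p = - (b * t).
Proof.
move=> nX rXY /idlP[_ [_ [/inpriP[al ->] /inpriP[be ->] EX]]].
move=> /idlP[_ [_ [/inpriP[ga ->] /inpriP[de ->] EY]]] p q /eqP.
rewrite addr_eq0 => /eqP E0; pose h := al * q - be * p.
have Eah : a * h = X * q.
  rewrite /h mulrBr mulrCA [a * (be * p)]mulrCA E0 EX; ring.
have Ebh : b * h = - (X * p).
  have E0' : b * q = - (a * p) by rewrite E0 opprK.
  rewrite /h mulrBr mulrCA E0' EX; ring.
have [|t Et] := rXY (ga * q - de * p) h.
  rewrite EY mulrDl -!mulrA [a * _]mulrCA [b * _]mulrCA Eah Ebh.
  by ring.
exists t; split; apply: (nzd_inj nX).
  by rewrite -Eah Et; ring.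
by rewrite -[LHS]opprK -Ebh Et; ring.
Qed.

Lemma idl_exp_add A B i j : {subset (A + B) ^+ (i + j) <= A ^+ i + B ^+ j}.
Proof.
have [n le_n] := ubnP (i + j); elim: n i j le_n => // n IH [|i] [|j] le_n;
  rewrite ?expr0; try (by move=> x _; apply/sub_addl/idl1);
  try (by move=> x _; apply/sub_addr/idl1).
rewrite addnS exprS mulrDl; apply: add_sub => x.
  rewrite addSnnS => /(idl_mulSr (IH i j.+1 _)) H.
  have /H : (i + j.+1 < n)%N by move: le_n; lia.
  rewrite mulrDr [A ^+ i.+1]exprS; apply: idl_addS => {x H} //.
move=> /(idl_mulSr (IH i.+1 j _)) H.
have /H : (i.+1 + j < n)%N by move: le_n; lia.
by rewrite mulrDr [B ^+ j.+1]exprS; apply: idl_addS => {x H} //.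
Qed.

End RegularPairs.

(** * Systems of parameters and the length formula *)

Section LocalRegularPairs.
Context {R : comPzRingType} {m : idl R} (Rm : noeth_local m).
Implicit Types (A B K U : idl R) (a b c x y z : R).

Lemma regmodX x y n : nzd x -> regmod x y -> regmod (x ^+ n) y.
Proof.
move=> nx rxy; elim: n => [|n IH] p q E; first by exists q; rewrite mul1r.
have [|t Et] := rxy (x ^+ n * p) q; first by rewrite mulrA -exprS.
have [|u Eu] := IH p t; last by exists u; rewrite Et Eu exprS mulrA.
by apply: (nzd_inj nx); rewrite mulrA -exprS E Et; ring.
Qed.

Lemma regmodXr x y n : regmod x y -> regmod x (y ^+ n).
Proof.
move=> rxy; elim: n => [|n IH] p q E; first by exists p; rewrite E mul1r.
have [t Et] : exists t, y * q = x * t by apply: (IH p); rewrite E exprS; ring.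
by apply: (rxy t); rewrite Et.
Qed.

(** Powers of [x] and [y] lie in (a, b), so by [koszul_syzygy] all syzygies of (a, b) are Koszul. An
    annihilator of [a] is then [b] times an annihilator of [a], hence zero by Nakayama; likewise
    with [a] and [b] exchanged. *)
Lemma regpair_prim a b x y : a \in m -> b \in m -> x \in m -> y \in m ->
  nzd x -> regmod x y -> mprim m (pri a + pri b) -> regpair a b.
Proof.
move=> am bm xm ym nx rxy [n mn].
have syz := @koszul_syzygy _ a b (x ^+ n) (y ^+ n) (nzdX nx)
  (regmodXr (regmodX nx rxy)) (mn _ (idlX n xm)) (mn _ (idlX n ym)).
have H c d : d \in m -> (forall z, c * z = 0 -> exists t, z = d * t /\ c * t = 0) ->
    nzd c.
  move=> dm cd z cz; have sub : {subset icol 0 c <= (0 : idl R)}.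
    apply: (nakayama Rm) => u; rewrite add0r memc in_idl0 mulrC => /eqP/cd.
    move=> [t [-> ct]]; apply: idlM => //.
    by rewrite memc in_idl0 mulrC ct.
  by apply/eqP; rewrite -in_idl0; apply: sub; rewrite memc in_idl0 mulrC cz.
split.
- apply: (H a b bm) => z az.
  have [|t [at0 ->]] := syz z 0; first by rewrite az mulr0 addr0.
  by exists (- t); rewrite !mulrN -at0 oppr0.
- apply: (H b a am) => z bz.
  have [|t [-> bt0]] := syz 0 z; first by rewrite bz mulr0 addr0.
  by exists t; split=> //; apply/eqP; rewrite -oppr_eq0 -bt0.
move=> p q E; have [|t [-> _]] := syz (- p) q; last by exists t.
by rewrite mulrN E addNr.
Qed.

Lemma mprim_add a b A B : mprim m (pri a + pri b) -> mprim m A -> mprim m B ->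
  mprim m (pri a * A + pri b * B).
Proof.
move=> mab mA mB; apply: mprimS (mprimM mab (mprimM mA mB)).
rewrite mulrDl; apply: idl_addS; apply: idl_mulSr; [exact: sub_mull|].
exact: sub_mulr.
Qed.

Section JointColength.
Variables (a b : R) (ab : regpair a b) (mab : mprim m (pri a + pri b)).

(** Cut by [a], then cut both resulting ideals by [b]; compare with [A] cut by [b] and [B] cut by
    [a]. The length of the intersection of the two colons appears as the sum of their lengths minus
    that of their sum. *)
Lemma colen_joint A B : mprim m A -> mprim m B ->
  (colen (pri a * A + pri b * B) + colen (icol A b) + colen (icol B a) =
   colen (pri a + pri b) + colen A + colen B +
     colen (icol A b + icol B a))%N.
Proof.
move=> mA mB; have [na nb rab] := ab.
have fA := mprim_colfin Rm mA; have fB := mprim_colfin Rm mB.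
have fK := mprim_colfin Rm (mprim_add mab mA mB).
have mK2 : mprim m (pri a + pri b * B).
  by apply: mprimS (mprim_add mab mA mB); apply: idl_addS.
have mK3 : mprim m (A + pri b * icol B a) by apply: mprimDl.
have := colen_exact a fK; rewrite (icol_joint A B ab).
have -> : pri a * A + pri b * B + pri a = pri a + pri b * B.
  by rewrite addrAC (add_subr (@sub_mull _ _ _)).
have := colen_exact b (mprim_colfin Rm mK2); rewrite (icolDM B rab nb).
have -> : pri a + pri b * B + pri b = pri a + pri b.
  by rewrite -addrA (add_subr (@sub_mull _ _ _)).
have := colen_exact b (mprim_colfin Rm mK3); rewrite (icolM A _ nb).
have -> : A + pri b * icol B a + pri b = A + pri b.
  by rewrite -addrA (add_subr (@sub_mull _ _ _)).
have := colen_exact b fA; have := colen_exact a fB.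
rewrite [B + pri a]addrC; colen_lia.
Qed.

(** [U] stands in for the intersection of the two colons; submodularity supplies the comparison. *)
Lemma colen_joint_ge A B U : mprim m U ->
  {subset U <= icol A b} -> {subset U <= icol B a} ->
  mprim m A -> mprim m B ->
  (colen (pri a + pri b) + colen A + colen B <=
   colen (pri a * A + pri b * B) + colen U)%N.
Proof.
move=> mU UA UB mA mB; have := colen_joint mA mB.
have := colen_submod_idl Rm (icol B a) UA mU.
rewrite (add_subr UB); colen_lia.
Qed.

Lemma colen_joint_le A B : mprim m A -> mprim m B ->
  (colen (pri a * A + pri b * B) <=
   colen (pri a + pri b) + colen A + colen B)%N.
Proof.
move=> mA mB; have := colen_joint mA mB.
have := leq_colen_prim Rm (@sub_addl _ (icol A b) (icol B a)) (mprimC b mA).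
colen_lia.
Qed.

Lemma colen_joint_eq A B : mprim m A -> mprim m B -> b \in A -> a \in B ->
  colen (pri a * A + pri b * B) =
  (colen (pri a + pri b) + colen A + colen B)%N.
Proof.
move=> mA mB bA aB; have := colen_joint mA mB.
by rewrite (col1 bA) (col1 aB) (@add_subr _ 1 1) // colen1 !addn0.
Qed.

End JointColength.

Lemma colen_priM a a' b : regpair a b -> mprim m (pri (a * a') + pri b) ->
  colen (pri (a * a') + pri b) = (colen (pri a + pri b) + colen (pri a' + pri b))%N.
Proof.
move=> [na nb rab] mK; have := colen_exact a (mprim_colfin Rm mK).
rewrite priM [pri a * _ + _]addrC (icolM _ _ na).
have -> : icol (pri b) a = pri b.
  apply: idl_anti => z; last exact: subc.
  rewrite memc => /inpriP[t E]; have [|u Eu] := rab z t.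
    by rewrite mulrC.
  apply/inpriP; exists u; apply: (nzd_inj na).
  by rewrite mulrC E Eu; ring.
by rewrite -addrA (add_subr (@sub_mull _ _ _)) [pri b + pri a]addrC
  [pri b + pri a']addrC.
Qed.

Lemma colen_priXl a b n : regpair a b -> mprim m (pri a + pri b) ->
  mprim m (pri (a ^+ n) + pri b) /\
  colen (pri (a ^+ n) + pri b) = (n * colen (pri a + pri b))%N.
Proof.
move=> ab mab; elim: n => [|n [IH1 IH2]].
  rewrite expr0 pri1 (_ : 1 + pri b = 1).
    by rewrite colen1; split=> //; apply: mprim1.
  by apply: idl_eq1; apply: sub_addl.
have mK : mprim m (pri (a ^+ n.+1) + pri b).
  apply: mprimS (mprimM mab IH1); rewrite exprS priM mulrDl mulrDr.
  apply: add_sub; last first.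
    by move=> x /sub_mull; apply: sub_addr.
  by apply: idl_addS => //; apply: sub_mulr.
by split=> //; rewrite exprS colen_priM -?exprS // IH2 mulSn.
Qed.

Lemma colen_priX a b n k : regpair a b -> mprim m (pri a + pri b) ->
  mprim m (pri (a ^+ n) + pri (b ^+ k)) /\
  colen (pri (a ^+ n) + pri (b ^+ k)) = (n * k * colen (pri a + pri b))%N.
Proof.
move=> ab mab; have [mn En] := colen_priXl n ab mab.
rewrite addrC in mn; rewrite addrC.
have [] := colen_priXl k (regpair_sym (regpairXl n ab)) mn.
by rewrite (addrC (pri b) (pri (a ^+ n))) En => ? ->; split=> //; lia.
Qed.

(** Bounds the minimal number of generators of [K] by l(c, y) + 1: the colon (m K : c) contains [m],
    while [m K + (c)] contains [(c) + y K], of length l(c, y) + l(K) because [y] is regular modulo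
    [c]. *)
Lemma colen_mul_m K c y : mprim m K -> mprim m (pri c + pri y) -> c \in K -> y \in m ->
  nzd y -> regmod c y ->
  (colen (m * K) <= colen K + colen (pri c + pri y) + 1)%N.
Proof.
move=> mK mcy cK ym ny rcy.
have mmK := mprimM (@mprim_m _ m) mK.
have := colen_exact c (mprim_colfin Rm mmK).
have : (colen (icol (m * K) c) <= 1)%N.
  by apply: (colen_m_le Rm) => z zm; rewrite memc; apply: idlM.
have myK : mprim m (pri c + pri y * K).
  by apply: mprimS (mprim_add mcy (@mprim1 _ m) mK); rewrite mulr1.
have := colen_exact y (mprim_colfin Rm myK).
rewrite (icolDM _ rcy ny) -addrA (add_subr (@sub_mull _ _ _)).
rewrite (add_subr (pri_sub cK)).
have : (colen (m * K + pri c) <= colen (pri c + pri y * K))%N.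
  apply: (leq_colen_prim Rm) myK; rewrite addrC; apply: idl_addS => //.
  exact: pri_mulS.
colen_lia.
Qed.

End LocalRegularPairs.

(** * Hilbert functions *)

Section JointFamily.
Context {R : comPzRingType}.
Variables (U : nat -> nat -> idl R) (a b : R).
Hypotheses (aU : forall r s, {subset pri a * U r s <= U r.+1 s})
           (bU : forall r s, {subset pri b * U r s <= U r s.+1}).

Lemma joint_family_sup k l :
  {subset pri (a ^+ k) * U 0 l + pri (b ^+ l) * U k 0 <= U k l}.
Proof.
apply: add_sub.
  elim: k => [|k IH] x; first by rewrite expr0 pri1 mul1r.
  by rewrite exprS priM -mulrA => /(idl_mulSr IH); apply: aU.
elim: l => [|l IH] x; first by rewrite expr0 pri1 mul1r.
by rewrite exprS priM -mulrA => /(idl_mulSr IH); apply: bU.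
Qed.

Hypothesis Usplit : forall r s,
  {subset U r.+1 s.+1 <= pri a * U r s.+1 + pri b * U r.+1 s}.

Lemma joint_family_sub k l :
  {subset U k l <= pri (a ^+ k) * U 0 l + pri (b ^+ l) * U k 0}.
Proof.
elim: k l => [|k IHk] l; first by rewrite expr0 pri1 mul1r; apply: sub_addl.
elim: l => [|l IHl]; first by rewrite expr0 pri1 mul1r; apply: sub_addr.
move=> x /Usplit; apply: add_sub x => x.
  move=> /(idl_mulSr (IHk l.+1)); rewrite mulrDr.
  apply: idl_addS => {}x; first by rewrite exprS priM mulrA.
  by rewrite mulrCA => H; apply: idl_mulSr x H; apply: aU.
move=> /(idl_mulSr IHl); rewrite mulrDr; apply: idl_addS => {}x.
  by rewrite mulrCA => H; apply: idl_mulSr x H; apply: bU.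
by rewrite exprS priM mulrA.
Qed.

Context {m : idl R} (Rm : noeth_local m).
Hypotheses (ab : regpair a b) (mab : mprim m (pri a + pri b)).
Hypothesis mU : forall r s, mprim m (U r s).

Local Notation e := (colen (pri a + pri b)).
Local Notation H r s := (colen (U r s)).

Let step r s : (e + H r s.+1 + H r.+1 s <= H r.+1 s.+1 + H r s)%N.
Proof.
have := colen_joint_ge Rm ab mab (mU r s) _ _ (mU r s.+1) (mU r.+1 s).
have -> : pri a * U r s.+1 + pri b * U r.+1 s = U r.+1 s.+1.
  by apply: idl_anti => //; apply: add_sub.
apply=> x xU; rewrite memc mulrC.
  by apply/bU/idlM => //; apply: mem_pri.
by apply/aU/idlM => //; apply: mem_pri.
Qed.

Let bound k l : (H k l <= k * l * e + H 0 l + H k 0)%N.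
Proof.
have [mkl Ekl] := colen_priX Rm k l ab mab.
have abX := regpairX k l ab.
apply: leq_trans (leq_colen_prim Rm (@joint_family_sup k l) _) _.
  exact: mprim_add.
by rewrite -Ekl; apply: (colen_joint_le Rm).
Qed.

(* The second mixed difference of [H] exceeds [e] by some [E r s >= 0], whose
   sum over all [r] and [s] is at most [H 0 0]; so [E] has finite support. *)
Lemma joint_family_mixed : exists N, forall r s, (N <= r)%N -> (N <= s)%N ->
  (H r.+1 s.+1 + H r s = e + H r s.+1 + H r.+1 s)%N.
Proof.
have mono1 k l : (H k l + H k.+1 0 + l * e <= H k.+1 l + H k 0)%N.
  elim: l => [|l IH]; first by rewrite mul0n; lia.
  by have := step k l; rewrite mulSn; lia.
have mono2 k l : (H k l + H 0 l.+1 + k * e <= H k l.+1 + H 0 l)%N.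
  elim: k => [|k IH]; first by rewrite mul0n; lia.
  by have := step k l; rewrite mulSn; lia.
have pos k l : (H 0 l + H k 0 + k * l * e <= H k l + H 0 0)%N.
  elim: k => [|k IH]; first by rewrite !mul0n; lia.
  by have := mono1 k l; rewrite mulSn mulnDl; lia.
(* [F k l] is the sum of [E r s] over [r < k] and [s < l]; by [pos] the truncated subtraction is
   exact. *)
pose F k l := (H k l + H 0 0 - (H 0 l + H k 0 + k * l * e))%N.
have F1 k l : (F k l <= F k.+1 l)%N.
  rewrite /F; have := mono1 k l; have := pos k l; have := pos k.+1 l.
  by rewrite mulSn mulnDl; lia.
have F2 k l : (F k l <= F k l.+1)%N.
  rewrite /F; have := mono2 k l; have := pos k l; have := pos k l.+1.
  by rewrite mulnS mulnDl; lia.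
have Fb k l : (F k l <= H 0 0)%N by rewrite /F; have := bound k l; lia.
have Fmono k l k' l' : (k <= k')%N -> (l <= l')%N -> (F k l <= F k' l')%N.
  move=> /subnKC <- /subnKC <-; apply: (@leq_trans (F k (l + (l' - l))%N)).
    by elim: (l' - l)%N => [|i IH]; rewrite ?addn0 // addnS (leq_trans IH).
  by elim: (k' - k)%N => [|i IH]; rewrite ?addn0 // addnS (leq_trans IH).
have ex : exists v, `[< exists k l, F k l = v >].
  by exists (F 0 0)%N; apply/asboolP; exists 0%N, 0%N.
have bd v : `[< exists k l, F k l = v >] -> (v <= H 0 0)%N.
  by move/asboolP => [k [l <-]].
case: (ex_maxnP ex bd) => v /asboolP[k0 [l0 Fv]] vmax.
have Fv' r s : (maxn k0 l0 <= r)%N -> (maxn k0 l0 <= s)%N -> F r s = v.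
  rewrite !geq_max => /andP[kr lr] /andP[ks ls].
  apply/eqP; rewrite eqn_leq vmax ?asboolE; last by exists r, s.
  by rewrite -Fv Fmono.
exists (maxn k0 l0) => r s Nr Ns.
have := Fv' _ _ Nr Ns; have := Fv' _ _ (leqW Nr) Ns.
have := Fv' _ _ Nr (leqW Ns); have := Fv' _ _ (leqW Nr) (leqW Ns).
have := pos r s; have := pos r.+1 s; have := pos r s.+1; have := pos r.+1 s.+1.
by rewrite /F !mulSn !mulnS !mulnDl; lia.
Qed.

End JointFamily.

(** * Polynomial forms in one and two variables *)

Section HilbertForms.
Implicit Types (G : nat -> nat) (H : nat -> nat -> nat) (e p q : int).

Definition hilb_form G e0 e1 e2 := exists N, forall n, (N <= n)%N ->
  (G n)%:Z = e0 * 'C(n.+1, 2)%:Z - e1 * n%:Z + e2.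

Definition bihilb_form H e20 e02 e11 e10 e01 e00 :=
  exists N, forall r s, (N <= r)%N -> (N <= s)%N ->
  (H r s)%:Z = e20 * 'C(r.+1, 2)%:Z + e02 * 'C(s.+1, 2)%:Z +
     e11 * (r%:Z * s%:Z) - e10 * r%:Z - e01 * s%:Z + e00.

Lemma binS2 n : 'C(n.+2, 2)%:Z = 'C(n.+1, 2)%:Z + n%:Z + 1 :> int.
Proof. by rewrite binS bin1; lia. Qed.

Lemma square_bin2 n : n%:Z * n%:Z = 2 * 'C(n.+1, 2)%:Z - n%:Z :> int.
Proof.
elim: n => [|n IH]; first by rewrite bin_small.
have -> : n.+1%:Z * n.+1%:Z = n%:Z * n%:Z + 2 * n%:Z + 1 :> int by lia.
by rewrite IH binS2; lia.
Qed.

Lemma quad_seq G (e N : nat) :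
  (forall n, (N <= n)%N -> G n.+2 + G n = e + 2 * G n.+1)%N ->
  exists e1 e2, hilb_form G e%:Z e1 e2.
Proof.
(* [d] and [e2] are determined by interpolation at [N] and [N + 1]. *)
move=> D; pose d : int := (G N.+1)%:Z - (G N)%:Z - e%:Z * N.+1%:Z.
pose e2 : int := (G N)%:Z - e%:Z * 'C(N.+1, 2)%:Z - d * N%:Z.
exists (- d), e2, N => n Nn.
suff [] : (G n)%:Z = e%:Z * 'C(n.+1, 2)%:Z - (- d) * n%:Z + e2 /\
    (G n.+1)%:Z - (G n)%:Z = d + e%:Z * n.+1%:Z by [].
elim: n Nn => [|n IH]; last rewrite leq_eqVlt => /orP[/eqP<-|Nn].
- by rewrite leqn0 => /eqP N0; rewrite /e2 /d N0; split; ring.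
- by rewrite /e2 /d; split; ring.
have [E1 E2] := IH Nn; have := D n Nn => E3; split; last by lia.
rewrite binS2.
have -> : (G n.+1)%:Z = (G n)%:Z + (d + e%:Z * n.+1%:Z) by lia.
rewrite E1; have -> : n.+1%:Z = n%:Z + 1 :> int by lia.
by ring.
Qed.

Lemma hilb_form_uniq G a0 a1 a2 b0 b1 b2 :
  hilb_form G a0 a1 a2 -> hilb_form G b0 b1 b2 ->
  [/\ a0 = b0, a1 = b1 & a2 = b2].
Proof.
move=> [N HN] [M HM]; set n := maxn N M.
have [Nn Mn] : (N <= n)%N /\ (M <= n)%N by rewrite leq_maxl leq_maxr.
have E i : a0 * 'C((n + i).+1, 2)%:Z - a1 * (n + i)%:Z + a2 =
           b0 * 'C((n + i).+1, 2)%:Z - b1 * (n + i)%:Z + b2.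
  by rewrite -HN -?HM //; lia.
have := E 0%N; have := E 1%N; have := E 2%N.
rewrite !addnS !addn0 !binS2 => {HN HM E}.
set c := 'C(_, 2)%:Z.
have -> : n.+2%:Z = n%:Z + 2 :> int by lia.
have -> : n.+1%:Z = n%:Z + 1 :> int by lia.
move: c (n%:Z) => c x E2 E1 E0.
have F0 : a0 = b0 by lia.
have F1 : a1 = b1 by subst b0; lia.
by split=> //; subst b0 b1; lia.
Qed.

End HilbertForms.

(** The Cohen-Macaulay property in dimension two takes the form of a regular pair that generates an
    m-primary ideal. *)
Record local_cm2 (R : comNzRingType) (m : idl R) : Prop := LocalCM2 {
  cm2_noeth : noeth_local m;
  cm2_inf : forall n, exists2 ts : seq R, distinct_mod (m := m) ts &
    size ts = n;
  cm2_reg : exists x y : R, [/\ x \in m, y \in m, regpair x y &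
    mprim m (pri x + pri y)]
}.

(** * Joint reductions and their Hilbert polynomials *)

Section JointReductionExistence.
Context {R : comNzRingType} {m : idl R} (Rm : local_cm2 m).
Implicit Types (A B K I J : idl R) (a b c x y z : R).

Let Rn := cm2_noeth Rm.

(** A single pair of exponents is enough: by [jrel_le] the relation passes to larger ones. The
    reverse inclusion is automatic for [a] in [I] and [b] in [J]. *)
Definition jrel I J a b r s := {subset I ^+ r.+1 * J ^+ s.+1 <=
  pri a * (I ^+ r * J ^+ s.+1) + pri b * (I ^+ r.+1 * J ^+ s)}.

Lemma jrel_le I J a b r s r' s' : (r <= r')%N -> (s <= s')%N ->
  jrel I J a b r s -> jrel I J a b r' s'.
Proof.
move=> /subnKC<- /subnKC<-; move: (r' - r)%N (s' - s)%N => i j H.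
rewrite /jrel.
have -> : (I ^+ (r + i).+1 * J ^+ (s + j).+1) =
    (I ^+ i * J ^+ j) * (I ^+ r.+1 * J ^+ s.+1).
  by rewrite !exprS !exprD; ring.
move=> x /(idl_mulSr H); rewrite mulrDr.
have -> : I ^+ i * J ^+ j * (pri a * (I ^+ r * J ^+ s.+1)) =
    pri a * (I ^+ (r + i) * J ^+ (s + j).+1).
  by rewrite !exprS !exprD; ring.
have -> // : I ^+ i * J ^+ j * (pri b * (I ^+ r.+1 * J ^+ s)) =
    pri b * (I ^+ (r + i).+1 * J ^+ (s + j)).
by rewrite !exprS !exprD; ring.
Qed.

Lemma jrel_open I J r s : line_open (m := m) I J (fun a b => jrel I J a b r s).
Proof.
have H := @covers_open _ _ Rn I J (I ^+ r.+1 * J ^+ s.+1) 0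
  (I ^+ r * J ^+ s.+1) (I ^+ r.+1 * J ^+ s).
move=> x y x' y' xI yJ xI' yJ' Hxy.
have := H _ _ x y x' y' xI yJ xI' yJ'; rewrite /covers !add0r => {}H.
apply: cofinS (H _ _ Hxy) => [t|z|z].
- by rewrite add0r.
- by rewrite mulrA -exprS.
- by rewrite mulrCA -exprS.
Qed.

(* By [colen_mul_m], the minimal number of generators of [I ^+ n * J ^+ n] is at
   most linear in [n]. *)
Lemma jrel_exists I J : mprim m I -> mprim m J ->
  exists N, inhabited_in I J (fun a b => jrel I J a b N N).
Proof.
move=> mI mJ; have [x [y [xm ym xy mxy]]] := cm2_reg Rm.
have [i iI] := mI; have [j jJ] := mJ.
pose e := colen (pri x + pri y).
(* With this [N], (i + j)(N + 1) e is N (N + 1) / 2, so the number of generators of [K] stays below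
   the threshold (N + 2)^2 of [eakin_sathaye2]. *)
pose N := (2 * (i + j) * e)%N; exists N.
pose K := I ^+ N.+1 * J ^+ N.+1.
have mK : mprim m K by apply: mprimM; apply: mprimX.
have [mc Ec] := colen_priXl Rn ((i + j) * N.+1)%N xy mxy.
have cK : x ^+ ((i + j) * N.+1) \in K.
  rewrite mulnDl exprD !exprM; apply: idlM; apply: idlX.
    exact/iI/idlX.
  exact/jJ/idlX.
have [nx ny _] := xy; have [_ _ rc] := regpairXl ((i + j) * N.+1) xy.
have := colen_mul_m Rn mK mc cK ym ny rc; rewrite Ec -/e => le_mK.
have lt_mK : (colen (m * K) < colen (m * K + 1 * I ^+ N.+1 * J ^+ N.+1) +
    N.+2 * N.+2)%N.
  rewrite mul1r -/K (add_subr (@sub_mulr _ m K)).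
  suff : ((i + j) * N.+1 * e + 1 < N.+2 * N.+2)%N by lia.
  have EN : (2 * ((i + j) * e) = N)%N by rewrite /N; lia.
  suff : (2 * ((i + j) * N.+1 * e) = N * N.+1)%N by lia.
  by rewrite -EN; lia.
have mmK : mprim m (m * K) by apply: mprimM => //; apply: mprim_m.
have [a [b [aI bJ ab]]] := eakin_sathaye2 Rn (cm2_inf Rm) mmK lt_mK.
exists a, b; split=> //; rewrite /jrel -/K.
apply: (nakayama Rn) => z; move: (ab z).
by rewrite !mul1r /= -addrA addrC.
Qed.

Lemma jrel_mprim I J a b r s : mprim m I -> mprim m J -> jrel I J a b r s ->
  mprim m (pri a + pri b).
Proof.
move=> mI mJ H; apply: mprimS (mprimM (mprimX r.+1 mI) (mprimX s.+1 mJ)).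
by move=> x /H; apply: idl_addS; apply: sub_mull.
Qed.

Lemma cm2_regpair a b : a \in m -> b \in m -> mprim m (pri a + pri b) ->
  regpair a b.
Proof.
move=> am bm; have [x [y [xm ym [nx _ rxy] _]]] := cm2_reg Rm.
exact: (regpair_prim Rn am bm xm ym nx rxy).
Qed.

Section HilbertFunctions.
Variables (I J : idl R).
Hypotheses (Im : {subset I <= m}) (Jm : {subset J <= m}).
Hypotheses (mI : mprim m I) (mJ : mprim m J).

Lemma jrel_regpair a b r s : a \in I -> b \in J -> jrel I J a b r s ->
  regpair a b.
Proof.
by move=> aI bJ H; apply: cm2_regpair (jrel_mprim mI mJ H); [apply: Im|apply: Jm].
Qed.

(** The factor [K] allows an exponent to be frozen: [K = J^N] later gives the Hilbert polynomial in
    [r] alone. *)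
Lemma jrel_mixed a b r0 s0 K :
  a \in I -> b \in J -> jrel I J a b r0 s0 -> mprim m K ->
  exists N, forall r s, (N <= r)%N -> (N <= s)%N ->
  (colen (I ^+ r.+1 * J ^+ s.+1 * K) + colen (I ^+ r * J ^+ s * K) =
   colen (pri a + pri b) + colen (I ^+ r * J ^+ s.+1 * K) +
   colen (I ^+ r.+1 * J ^+ s * K))%N.
Proof.
move=> aI bJ H mK; pose U r s := I ^+ (r0 + r) * J ^+ (s0 + s) * K.
have aU r s : {subset pri a * U r s <= U r.+1 s}.
  have -> : U r.+1 s = I * U r s by rewrite /U addnS exprS; ring.
  exact: pri_mulS.
have bU r s : {subset pri b * U r s <= U r s.+1}.
  have -> : U r s.+1 = J * U r s by rewrite /U addnS exprS; ring.
  exact: pri_mulS.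
have Usplit r s :
    {subset U r.+1 s.+1 <= pri a * U r s.+1 + pri b * U r.+1 s}.
  rewrite /U !addnS => x.
  move=> /(idl_mulSl (jrel_le (leq_addr r r0) (leq_addr s s0) H)).
  by rewrite mulrDl -!mulrA.
have mU r s : mprim m (U r s).
  by apply: mprimM => //; apply: mprimM; apply: mprimX.
have [N HN] := joint_family_mixed aU bU Usplit Rn
  (jrel_regpair aI bJ H) (jrel_mprim mI mJ H) mU.
exists (N + r0 + s0)%N => r s Nr Ns.
have := HN (r - r0)%N (s - s0)%N; rewrite /U !addnS !subnKC; lia.
Qed.

End HilbertFunctions.

(** For [J = I] a joint reduction is an ordinary reduction, and the mixed second difference of a
    function of r + s is its ordinary second difference. *)
Lemma red_diff2 I a a' r s K : {subset I <= m} -> mprim m I -> a \in I ->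
  a' \in I -> jrel I I a a' r s -> mprim m K ->
  exists N, forall n, (N <= n)%N ->
  (colen (I ^+ n.+2 * K) + colen (I ^+ n * K) =
   colen (pri a + pri a') + 2 * colen (I ^+ n.+1 * K))%N.
Proof.
move=> Im mI aI aI' H mK.
have [N HN] := jrel_mixed Im Im mI mI aI aI' H mK.
exists (N + N)%N => n Nn.
have := HN N (n - N)%N (leqnn N); rewrite -!exprD => HNn.
have {HNn} := HNn ltac:(lia).
have -> : (N.+1 + (n - N).+1 = n.+2)%N by lia.
have -> : (N + (n - N) = n)%N by lia.
have -> : (N + (n - N).+1 = n.+1)%N by lia.
have -> : (N.+1 + (n - N) = n.+1)%N by lia.
lia.
Qed.

Lemma red_hilb I a a' r s K : {subset I <= m} -> mprim m I -> a \in I ->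
  a' \in I -> jrel I I a a' r s -> mprim m K ->
  exists e1 e2, hilb_form (fun n => colen (I ^+ n * K))
    (colen (pri a + pri a'))%:Z e1 e2.
Proof.
move=> Im mI aI aI' H mK.
have [N HN] := red_diff2 Im mI aI aI' H mK.
exact: quad_seq HN.
Qed.

(** Since the mixed difference is constant beyond [N], the function is determined by the row and the
    column through (N, N), each a polynomial of one variable for large exponents. *)
Lemma jrel_bihilb I J a b r s a1 a2 r1 s1 b1 b2 r2 s2 :
  {subset I <= m} -> {subset J <= m} -> mprim m I -> mprim m J ->
  a \in I -> b \in J -> jrel I J a b r s ->
  a1 \in I -> a2 \in I -> jrel I I a1 a2 r1 s1 ->
  b1 \in J -> b2 \in J -> jrel J J b1 b2 r2 s2 ->
  exists e10 e01 e00, bihilb_form (fun r s => colen (I ^+ r * J ^+ s))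
    (colen (pri a1 + pri a2))%:Z (colen (pri b1 + pri b2))%:Z
    (colen (pri a + pri b))%:Z e10 e01 e00.
Proof.
move=> Im Jm mI mJ aI bJ jab a1I a2I ja b1J b2J jb.
have [N HN] := jrel_mixed Im Jm mI mJ aI bJ jab (@mprim1 _ m).
have [p1 [p2 [N1 H1]]] := red_hilb Im mI a1I a2I ja (mprimX N mJ).
have [q1 [q2 [N2 H2]]] := red_hilb Jm mJ b1J b2J jb (mprimX N mI).
set e := colen (pri a + pri b) in HN *.
pose h r s := colen (I ^+ r * J ^+ s).
have E r' s' : (N <= r')%N -> (N <= s')%N -> (h r' s')%:Z + (h N N)%:Z =
    (h r' N)%:Z + (h N s')%:Z + (r'%:Z - N%:Z) * (s'%:Z - N%:Z) * e%:Z.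
  move=> Nr Ns; rewrite -(subnKC Nr) -(subnKC Ns).
  move: (r' - N)%N (s' - N)%N => i j {r' s' Nr Ns}.
  suff : (h (N + i) (N + j) + h N N = h (N + i) N + h N (N + j) + i * j * e)%N.
    have -> : (N + i)%N%:Z - N%:Z = i%:Z by lia.
    have -> : (N + j)%N%:Z - N%:Z = j%:Z by lia.
    by rewrite -!PoszM; lia.
  have {}HN i' j' : (h (N + i').+1 (N + j').+1 + h (N + i') (N + j') =
      e + h (N + i') (N + j').+1 + h (N + i').+1 (N + j'))%N.
    by have := HN (N + i')%N (N + j')%N (leq_addr _ _) (leq_addr _ _);
      rewrite !mulr1.
  elim: i j => [|i IHi] j; first by rewrite addn0 mul0n; lia.
  elim: j => [|j IHj]; first by rewrite addn0 muln0; lia.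
  move: (IHi j) (IHi j.+1) IHj (HN i j); rewrite !addnS mulSn mulnS.
  by lia.
exists (p1 + e%:Z * N%:Z), (q1 + e%:Z * N%:Z),
  (p2 + q2 - (h N N)%:Z + e%:Z * (N%:Z * N%:Z)).
exists (N + N1 + N2)%N => r' s' Nr Ns.
have := H1 r'; have := H2 s'; have := E r' s'.
rewrite [J ^+ s' * _]mulrC -/(h r' N) -/(h N s') -/(h r' s').
move=> -/(_ ltac:(lia) ltac:(lia)) E1 -/(_ ltac:(lia)) E2.
move=> -/(_ ltac:(lia)) E3.
have -> : (h r' s')%:Z = (h r' N)%:Z + (h N s')%:Z - (h N N)%:Z +
  (r'%:Z - N%:Z) * (s'%:Z - N%:Z) * e%:Z by lia.
by rewrite E2 E3; ring.
Qed.

End JointReductionExistence.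

(** * Superficial elements *)

Section Superficial.
Context {R : comNzRingType} {m : idl R} (Rm : local_cm2 m).
Variables (I : idl R) (a1 a2 : R) (r s : nat).
Hypotheses (Im : {subset I <= m}) (mI : mprim m I).
Hypotheses (a1I : a1 \in I) (a2I : a2 \in I) (red : jrel I I a1 a2 r s).
(** All powers of [I] are Ratliff-Rush closed, as [closed_exp] makes explicit. *)
Hypothesis closed : forall n z,
  (forall x, x \in I -> z * x \in I ^+ n.+1) -> z \in I ^+ n.
Implicit Types (t u x y z : R) (ts us : seq R).

Let Rn := cm2_noeth Rm.
Let a t := a1 + t * a2.

Lemma closed_exp n k z :
  (forall x, x \in I ^+ k -> z * x \in I ^+ (n + k)) -> z \in I ^+ n.
Proof.
elim: k z => [|k IH] z Hz; first by have := Hz 1 (idl1 1); rewrite mulr1 addn0.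
apply: IH => y yI; apply: closed => x xI.
by rewrite -mulrA -addnS; apply: Hz; rewrite exprSr; apply: idlM.
Qed.

Let N0 := (r + s).+1.

Let redE n : (N0 <= n)%N ->
  {subset I ^+ n.+1 <= pri a1 * I ^+ n + pri a2 * I ^+ n}.
Proof.
move=> /subnKC E x; have := @jrel_le _ _ _ _ _ r s (r + (n - N0)) s
  (leq_addr _ _) (leqnn s) red x.
rewrite /jrel -!exprD.
have -> : ((r + (n - N0)).+1 + s.+1 = n.+1)%N by rewrite /N0 in E *; lia.
have -> : (r + (n - N0) + s.+1 = n)%N by rewrite /N0 in E *; lia.
by have -> : ((r + (n - N0)).+1 + s = n)%N by rewrite /N0 in E *; lia.
Qed.

Lemma closed_red n z : z * a1 \in I ^+ n.+1 -> z * a2 \in I ^+ n.+1 ->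
  z \in I ^+ n.
Proof.
move=> z1 z2; apply: (@closed_exp _ N0.+1) => x /(redE (leqnn _)).
move=> /idlP[_ [_ [/priP[u uI ->] /priP[v vI ->] ->]]].
by rewrite mulrDr !mulrA -addSnnS exprD; apply: idlD; apply: idlM.
Qed.

(** Two members of the pencil with incongruent parameters generate (a1, a2). *)
Lemma closed_pencil n z t u : t - u \notin m ->
  z * a t \in I ^+ n.+1 -> z * a u \in I ^+ n.+1 -> z \in I ^+ n.
Proof.
move=> tu zt zu.
have z2 : z * a2 \in I ^+ n.+1.
  apply: (unit_mem Rn tu).
  have -> : (t - u) * (z * a2) = z * a t - z * a u by rewrite /a; ring.
  exact: idlB.
apply: closed_red => //; have -> : z * a1 = z * a t - t * (z * a2).
  by rewrite /a; ring.
by apply: idlB => //; apply: idlMl.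
Qed.

Let aI t : a t \in I.
Proof. by apply: idlD => //; apply: idlMl. Qed.

Lemma closed_prod us n z t : all (fun u => t - u \notin m) us ->
  z * a t \in I ^+ n.+1 -> z * \prod_(u <- us) a u \in I ^+ (n + size us) ->
  z \in I ^+ n.
Proof.
elim: us n z => [|u us IH] n z /=; first by rewrite big_nil mulr1 addn0.
move=> /andP[tu tus] zt; rewrite big_cons mulrA addnS -addSn => zus.
apply: (closed_pencil tu) => //; apply: IH zus => //.
by rewrite mulrAC exprSr; apply: idlM.
Qed.

Let h n := colen (I ^+ n).
Let k t n := colen (icol (I ^+ n.+1) (a t)).

Let priaE t : pri (a t) + pri a2 = pri a1 + pri a2.
Proof.
apply: idl_anti; apply: add_sub; try exact: sub_addr; apply: pri_sub.
  apply: idlD; first exact/sub_addl/mem_pri.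
  exact/idlMl/sub_addr/mem_pri.
have -> : a1 = a t - t * a2 by rewrite /a; ring.
by apply: idlB; [exact/sub_addl/mem_pri|exact/idlMl/sub_addr/mem_pri].
Qed.

Let mQ : mprim m (pri a1 + pri a2) := jrel_mprim mI mI red.

Let prim_a t n : mprim m (I ^+ n + pri (a t)).
Proof. exact/mprimDl/mprimX. Qed.

(** Modulo [a t], [a1] is a multiple of [a2], so I^(n+1) + (a t) = a2 I^n + (a t). The increment
    does not depend on [t]. *)
Let colen_a t n : (N0 <= n)%N -> colen (I ^+ n.+1 + pri (a t)) =
  (colen (pri a1 + pri a2) + colen (I ^+ n + pri (a t)))%N.
Proof.
move=> Nn; have mt : mprim m (pri (a t) + pri a2) by rewrite priaE.
have [_ n2 rt] := cm2_regpair Rm (Im (aI t)) (Im a2I) mt.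
have E : I ^+ n.+1 + pri (a t) = pri (a t) + pri a2 * I ^+ n.
  apply: idl_anti; last first.
    rewrite addrC; apply: idl_addS => // x; rewrite exprS.
    exact: pri_mulS.
  apply: add_sub => [x /(redE Nn)|]; last exact: sub_addl.
  apply: add_sub x => x; last exact: sub_addr.
  move=> /priP[y yI ->].
  have -> : a1 * y = a t * y - a2 * (t * y) by rewrite /a; ring.
  apply: idlB; first by apply: sub_addl; apply/inpriP; exists y.
  by apply: sub_addr; apply/priP; exists (t * y) => //; apply: idlMl.
have := colen_exact a2 (mprim_colfin Rn (prim_a t n.+1)).
rewrite {2 3}E (icolDM _ rt n2) -addrA (add_subr (@sub_mull _ _ _)) priaE.
by rewrite [I ^+ n + _]addrC.
Qed.

(* The length of [(I^(n+1) : a t) / I^n] is constant for [n >= N1], where [N1]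
   does not depend on [t]. For distinct [t] for which it is not [0], choose
   [z t] in [(I^(N1+1) : a t)] outside [I^N1]. By [closed_prod] they generate a
   strictly increasing chain above [I^N1], so there are finitely many of them. *)
Lemma superficial_exists :
  cofin (m := m) (fun t => forall n, {subset icol (I ^+ n.+1) (a t) <= I ^+ n}).
Proof.
have [N HN] := red_diff2 Rm Im mI a1I a2I red (@mprim1 _ m).
have {}HN n : (N <= n)%N ->
    (h n.+2 + h n = colen (pri a1 + pri a2) + 2 * h n.+1)%N.
  by move=> /HN; rewrite !mulr1.
pose N1 := (N + N0)%N.
have fin n : colfin (I ^+ n) by apply/(mprim_colfin Rn)/mprimX.
have sub t n : {subset I ^+ n <= icol (I ^+ n.+1) (a t)}.
  by move=> x xI; rewrite memc exprSr; apply: idlM.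
have kh t n : (N1 <= n)%N -> k t N1 = h N1 -> k t n = h n.
  move=> /subnKC <- E; elim: (n - N1)%N => [|i IH]; first by rewrite addn0.
  rewrite addnS; set j := (N1 + i)%N in IH *.
  have := HN j; have := @colen_a t j.+1.
  have := colen_exact (a t) (fin j.+1); have := colen_exact (a t) (fin j.+2).
  rewrite -/(h j.+1) -/(h j.+2) -/(k t j) -/(k t j.+1).
  have ? : (N0 <= j.+1)%N by rewrite /j /N1; lia.
  have ? : (N <= j)%N by rewrite /j /N1; lia.
  by colen_lia.
have good t : {subset icol (I ^+ N1.+1) (a t) <= I ^+ N1} ->
    forall n, {subset icol (I ^+ n.+1) (a t) <= I ^+ n}.
  move=> H; have E : k t N1 = h N1.
    by rewrite /k /h; congr colen; apply: idl_anti.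
  have large n : (N1 <= n)%N -> {subset icol (I ^+ n.+1) (a t) <= I ^+ n}.
    move=> Nn; suff <- : I ^+ n = icol (I ^+ n.+1) (a t) by [].
    by apply: colen_inj (fin n) _ => //; rewrite -/(h n) -(kh t n) /k.
  (* For small [n], multiply by I^N1 to reach the stable range, then cancel that power. *)
  move=> n z; rewrite memc => za; apply: (@closed_exp _ N1) => x xI.
  apply: large; first exact: leq_addl.
  by rewrite memc mulrAC -addSn exprD; apply: idlM.
exists (h N1) => ts dts bad.
have [z zP] : exists z : R -> R, forall t, t \in ts ->
    z t * a t \in I ^+ N1.+1 /\ z t \notin I ^+ N1.
  suff H t : exists y, t \in ts -> y * a t \in I ^+ N1.+1 /\ y \notin I ^+ N1.
    by have [z zP] := choice H; exists z.
  have [tts|_] := boolP (t \in ts); last by exists 0.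
  apply: contrapT => H; apply: (bad t tts); apply: good => y.
  by rewrite memc => ya; apply: contrapT => /negP yI; apply: H; exists y.
(* The first conjunct is the invariant that lets [closed_prod] keep the next [z t] out of the ideal
   built so far. *)
suff [_] : (forall w, w \in I ^+ N1 + gens (map z ts) ->
      w * \prod_(u <- ts) a u \in I ^+ (N1 + size ts)) /\
    (size ts + colen (I ^+ N1 + gens (map z ts)) <= h N1)%N.
  by apply: leq_trans; apply: leq_addr.
elim: ts dts {bad} zP => [_ _|t ts IH].
  split=> [w|]; rewrite /= gens_nil addr0 ?add0n //.
  by rewrite big_nil mulr1 addn0.
rewrite /distinct_mod pairwise_cons => /andP[tts dts] zP.
have [|Hprod Hlen] := IH dts.
  by move=> u uts; apply: zP; rewrite inE uts orbT.
have [zt nzt] := zP t (mem_head _ _); rewrite /= gens_cons addrCA; split.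
  move=> _ /idlP[_ [w [/inpriP[c ->] /Hprod wP ->]]].
  rewrite big_cons mulrDl; apply: idlD; last first.
    by rewrite mulrCA addnS exprS; apply: idlM.
  have -> : z t * c * (a t * \prod_(u <- ts) a u) =
    c * (z t * a t * \prod_(u <- ts) a u) by ring.
  apply: idlMl; rewrite -addSnnS exprD; apply: idlM => //.
  elim: (ts) => [|u us IHu]; first by rewrite big_nil idl1.
  by rewrite big_cons exprS; apply: idlM.
apply: leq_trans Hlen; rewrite addSn -addnS leq_add2l.
apply: ltn_colen; first exact: sub_addr.
  move=> H; case/negP: nzt; apply: (@closed_prod ts _ _ t) => //.
  exact/Hprod/H/sub_addl/mem_pri.
exact: colfinS (fin N1).
Qed.

End Superficial.

(** * Joint reduction number zero *)

Section BigradedForms.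
Implicit Types (H : nat -> nat -> nat).

(** A polynomial of total degree two is determined by its values at the six points (n + i, n + j)
    with i + j <= 2. *)
Lemma bihilb_form_uniq H a20 a02 a11 a10 a01 a00 b20 b02 b11 b10 b01 b00 :
  bihilb_form H a20 a02 a11 a10 a01 a00 ->
  bihilb_form H b20 b02 b11 b10 b01 b00 ->
  [/\ a10 = b10, a01 = b01 & a00 = b00].
Proof.
move=> [N HN] [M HM]; set n := maxn N M.
have [Nn Mn] : (N <= n)%N /\ (M <= n)%N by rewrite leq_maxl leq_maxr.
pose E i j (x c : int) := 0 = (a20 - b20) * (c + i * x + 'C(`|i|.+1, 2)%:Z) +
  (a02 - b02) * (c + j * x + 'C(`|j|.+1, 2)%:Z) +
  (a11 - b11) * ((x + i) * (x + j)) - (a10 - b10) * (x + i) -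
  (a01 - b01) * (x + j) + (a00 - b00).
have bin_add i : 'C((n + i).+1, 2)%:Z =
    'C(n.+1, 2)%:Z + i%:Z * n%:Z + 'C(i.+1, 2)%:Z.
  elim: i => [|i IH]; first by rewrite addn0 (_ : 'C(1, 2) = 0%N) //; lia.
  by rewrite addnS !binS2 IH; lia.
have Eij i j : E i%:Z j%:Z n%:Z 'C(n.+1, 2)%:Z.
  have := HN (n + i)%N (n + j)%N; have := HM (n + i)%N (n + j)%N.
  rewrite /E !bin_add !PoszD => -/(_ ltac:(lia) ltac:(lia)) ->.
  move=> -/(_ ltac:(lia) ltac:(lia)) /eqP; rewrite -subr_eq0 => /eqP F.
  by rewrite -[LHS]oppr0 -[X in - X]F /=; ring.
have := Eij 0%N 0%N; have := Eij 1%N 0%N; have := Eij 2%N 0%N.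
have := Eij 0%N 1%N; have := Eij 0%N 2%N; have := Eij 1%N 1%N.
rewrite {Eij HN HM bin_add}/E /=.
move: 'C(n.+1, 2)%:Z n%:Z => c x.
rewrite (_ : 'C(1, 2) = 0%N) // (_ : 'C(2, 2) = 1%N) // (_ : 'C(3, 2) = 3%N) //.
move: (a20 - b20) (a02 - b02) (a11 - b11) => d20 d02 d11.
move=> E11 E02 E01 E20 E10 E00.
have D20 : d20 = 0 by lia.
have D02 : d02 = 0 by lia.
have D11 : d11 = 0 by subst d20 d02; lia.
subst d20 d02 d11; split; first by lia.
  by lia.
have F10 : a10 = b10 by lia.
have F01 : a01 = b01 by lia.
by subst b10 b01; lia.
Qed.

Lemma bihilb_diag H a20 a02 a11 a10 a01 a00 :
  bihilb_form H a20 a02 a11 a10 a01 a00 ->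
  hilb_form (fun n => H n n) (a20 + a02 + 2 * a11) (a11 + a10 + a01) a00.
Proof. by move=> [N HN]; exists N => n Nn; rewrite HN // square_bin2; ring. Qed.

End BigradedForms.

Lemma Posz_mul_add (i j e x y : nat) :
  (i * j * e + x + y)%N%:Z = i%:Z * j%:Z * e%:Z + x%:Z + y%:Z :> int.
Proof. by lia. Qed.

Section JointReductionZero.
Context {R : comNzRingType} {m : idl R} (Rm : local_cm2 m).
Variables (I J : idl R).
Hypotheses (Im : {subset I <= m}) (Jm : {subset J <= m}).
Hypotheses (mI : mprim m I) (mJ : mprim m J).
Implicit Types (a b x y z : R).

Let Rn := cm2_noeth Rm.

Lemma jrel0_power a b k l : a \in I -> b \in J -> jrel I J a b 0 0 ->
  I ^+ k * J ^+ l = pri (a ^+ k) * J ^+ l + pri (b ^+ l) * I ^+ k.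
Proof.
move=> aI bJ H; pose U r s := I ^+ r * J ^+ s.
have aU r s : {subset pri a * U r s <= U r.+1 s}.
  by rewrite /U exprS -mulrA; apply: pri_mulS.
have bU r s : {subset pri b * U r s <= U r s.+1}.
  by rewrite /U exprS mulrCA; apply/idl_mulSr/pri_mulS.
have Us r s : {subset U r.+1 s.+1 <= pri a * U r s.+1 + pri b * U r.+1 s}.
  exact: jrel_le H.
have := @joint_family_sup _ U a b aU bU k l.
have := @joint_family_sub _ U a b aU bU Us k l.
rewrite /U !expr0 !mulr1 !mul1r => le ge.
exact: idl_anti.
Qed.

Lemma jrel0_colen a b k l : a \in I -> b \in J -> jrel I J a b 0 0 ->
  colen (I ^+ k * J ^+ l) =
  (k * l * colen (pri a + pri b) + colen (I ^+ k) + colen (J ^+ l))%N.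
Proof.
move=> aI bJ H; have ab := jrel_regpair Rm Im Jm mI mJ aI bJ H.
have mab := jrel_mprim mI mJ H.
have [mX EX] := colen_priX Rn k l ab mab.
rewrite (jrel0_power k l aI bJ H).
rewrite (colen_joint_eq Rn (regpairX k l ab) mX) ?EX; try exact: mprimX;
  try exact: idlX.
lia.
Qed.

Lemma icol_exp_sub (K : idl R) a n k :
  (forall i, {subset icol (K ^+ i.+1) a <= K ^+ i}) ->
  {subset icol (K ^+ (n + k)) (a ^+ k) <= K ^+ n}.
Proof.
move=> Ka; elim: k => [|k IH] x; first by rewrite memc mulr1 addn0.
rewrite memc exprSr mulrA addnS => xa; apply: IH; rewrite memc.
exact: Ka xa.
Qed.

Lemma jrel0_of_colen a b r s N : a \in I -> b \in J -> jrel I J a b r s ->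
  (forall i, {subset icol (I ^+ i.+1) a <= I ^+ i}) ->
  (forall i, {subset icol (J ^+ i.+1) b <= J ^+ i}) ->
  colen (I ^+ N.+1 * J ^+ N.+1) = (N.+1 * N.+1 * colen (pri a + pri b) +
    colen (I ^+ N.+1) + colen (J ^+ N.+1))%N ->
  jrel I J a b 0 0.
Proof.
move=> aI bJ H Ia Jb E; have ab := jrel_regpair Rm Im Jm mI mJ aI bJ H.
have mab := jrel_mprim mI mJ H.
have [mX EX] := colen_priX Rn N.+1 N.+1 ab mab.
have := colen_joint_eq Rn (regpairX N.+1 N.+1 ab) mX
  (mprimX N.+1 mJ) (mprimX N.+1 mI) (idlX N.+1 bJ) (idlX N.+1 aI).
rewrite EX => EA.
have {EX EA}E' : pri (a ^+ N.+1) * J ^+ N.+1 + pri (b ^+ N.+1) * I ^+ N.+1 =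
    I ^+ N.+1 * J ^+ N.+1.
  apply: colen_inj; last by rewrite EA E; lia.
    apply: add_sub; first exact/pri_mulS/idlX.
    by rewrite mulrC; apply/idl_mulSr/pri_sub/idlX.
  apply: (mprim_colfin Rn); apply: (mprim_add mX); exact: mprimX.
move=> x; rewrite !expr1 !expr0 mul1r mulr1 => xIJ.
have : a ^+ N * b ^+ N * x \in I ^+ N.+1 * J ^+ N.+1.
  have -> : I ^+ N.+1 * J ^+ N.+1 = (I ^+ N * J ^+ N) * (I * J).
    by rewrite !exprS; ring.
  by apply: idlM => //; apply: idlM; apply: idlX.
rewrite -E' => /idlP[_ [_ [/priP[u uJ ->] /priP[v vI ->] Ex]]].
have [na nb _] := ab.
have [_ _ r1] := regpairX N.+1 N ab; have [_ _ r2] := regpairXl N ab.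
(* Regularity of powers gives u = b^N t and then v = a^N w. The colon conditions put [t] in [J] and
   [w] in [I], and x = a t + b w remains. *)
have E1 : a ^+ N.+1 * u = b ^+ N * (a ^+ N * x - b * v).
  have -> : a ^+ N.+1 * u = a ^+ N * b ^+ N * x - b ^+ N.+1 * v.
    by rewrite Ex addrK.
  by rewrite exprS; ring.
have [t Et] := r1 _ _ E1.
have Eu : u = t * b ^+ N.
  by apply: (nzd_inj (nzdX (n := N.+1) na)); rewrite E1 Et; ring.
have tJ : t \in J.
  by rewrite -[J]expr1; apply: (icol_exp_sub (k := N) Jb); rewrite memc -Eu.
have E2 : a ^+ N * (x - a * t) = b * v.
  rewrite -[RHS](subKr (a ^+ N * x)) Et exprS; ring.
have [w Ew] := r2 _ _ E2.
have wI : w \in I.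
  rewrite -[I]expr1; apply: (icol_exp_sub (k := N) Ia).
  by rewrite memc mulrC -Ew.
apply/idlP; exists (a * t), (b * w); split.
- by apply/priP; exists t.
- by apply/priP; exists w.
apply/eqP; rewrite addrC -subr_eq; apply/eqP.
by apply: (nzd_inj (nzdX (n := N) na)); rewrite E2 Ew; ring.
Qed.

Hypotheses
  (Icl : forall n z, (forall x, x \in I -> z * x \in I ^+ n.+1) -> z \in I ^+ n)
  (Jcl : forall n z, (forall x, x \in J -> z * x \in J ^+ n.+1) -> z \in J ^+ n).

(** Choose a reduction (x1, x2) of [K] with [P x1], then move along x1 + t x2: almost all [t]
    preserve [P], and almost all satisfy the colon conditions. *)
Lemma superficial_generic (K : idl R) (P : R -> Prop) :
  {subset K <= m} -> mprim m K ->
  (forall n z, (forall x, x \in K -> z * x \in K ^+ n.+1) -> z \in K ^+ n) ->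
  line_open (m := m) K K (fun x _ => P x) -> (exists2 x, x \in K & P x) ->
  exists x, [/\ x \in K, P x &
    forall i, {subset icol (K ^+ i.+1) x <= K ^+ i}].
Proof.
move=> Km mK Kcl oP [x0 x0K Px0].
have [N [y [z [yK zK yz]]]] := jrel_exists Rm mK mK.
have inP : inhabited_in K K (fun x _ => P x) by exists x0, x0.
have inJ : inhabited_in K K (fun x y => jrel K K x y N N) by exists y, z.
have [x1 [x2 [x1K x2K [Px1 red]]]] :=
  line_open_meet (cm2_inf Rm) oP (@jrel_open _ _ Rm K K N N) inP inJ.
have := superficial_exists Rm Km mK x1K x2K red Kcl.
have := oP x1 x2 x2 x2 x1K x2K x2K x2K Px1.
move=> /cofinI H /H/(cofin_ex (cm2_inf Rm))[t [Pt St]].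
by exists (x1 + t * x2); split=> //; apply: idlD => //; apply: idlMl.
Qed.

Lemma good_joint_reduction : exists a b N,
  [/\ a \in I, b \in J & jrel I J a b N N] /\
  (forall i, {subset icol (I ^+ i.+1) a <= I ^+ i}) /\
  (forall i, {subset icol (J ^+ i.+1) b <= J ^+ i}).
Proof.
have [N [a0 [b0 [a0I b0J H0]]]] := jrel_exists Rm mI mJ.
have oJ := @jrel_open _ _ Rm I J N N.
have [||a [aI H1 Sa]] :=
  @superficial_generic I (fun x => jrel I J x b0 N N) Im mI Icl.
- move=> x _ x' _ xI _ xI' _ Hx.
  have := oJ x b0 x' 0 xI b0J xI' (idl_mem0 J) Hx.
  by apply: cofinS => t; rewrite mulr0 addr0.
- by exists a0.
have [||b [bJ H2 Sb]] :=
  @superficial_generic J (fun y => jrel I J a y N N) Jm mJ Jcl.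
- move=> y _ y' _ yJ _ yJ' _ Hy.
  have := oJ a y 0 y' aI yJ (idl_mem0 I) yJ' Hy.
  by apply: cofinS => t; rewrite mulr0 addr0.
- by exists b0.
by exists a, b, N.
Qed.

(** [p0] and [q0] are shared with the bigraded form, and [c11] is the length l(a, b) for the pair of
    [good_joint_reduction]. The three equations thus say that l(I^r J^s) = r s l(a, b) + l(I^r) +
    l(J^s) for large r and s. *)
Lemma jrel0_hilbert : exists p0 p1 p2 q0 q1 q2 c11 c10 c01 c00,
  [/\ hilb_form (fun n => colen (I ^+ n)) p0 p1 p2,
      hilb_form (fun n => colen (J ^+ n)) q0 q1 q2,
      bihilb_form (fun r s => colen (I ^+ r * J ^+ s)) p0 q0 c11 c10 c01 c00 &
      (exists a b, [/\ a \in I, b \in J & jrel I J a b 0 0]) <->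
      [/\ c10 = p1, c01 = q1 & c00 = p2 + q2]].
Proof.
have [N1 [a1 [a2 [a1I a2I redI]]]] := jrel_exists Rm mI mI.
have [N2 [b1 [b2 [b1J b2J redJ]]]] := jrel_exists Rm mJ mJ.
have [a [b [N [[aI bJ ab] [Sa Sb]]]]] := good_joint_reduction.
have [p1 [p2 HI]] := red_hilb Rm Im mI a1I a2I redI (@mprim1 _ m).
have [q1 [q2 HJ]] := red_hilb Rm Jm mJ b1J b2J redJ (@mprim1 _ m).
have [c10 [c01 [c00 HIJ]]] :=
  jrel_bihilb Rm Im Jm mI mJ aI bJ ab a1I a2I redI b1J b2J redJ.
set p0 := (colen (pri a1 + pri a2))%:Z in HI HIJ *.
set q0 := (colen (pri b1 + pri b2))%:Z in HJ HIJ *.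
have {}HI : hilb_form (fun n => colen (I ^+ n)) p0 p1 p2.
  by have [M HM] := HI; exists M => n /HM; rewrite mulr1.
have {}HJ : hilb_form (fun n => colen (J ^+ n)) q0 q1 q2.
  by have [M HM] := HJ; exists M => n /HM; rewrite mulr1.
exists p0, p1, p2, q0, q1, q2, (colen (pri a + pri b))%:Z, c10, c01, c00.
split=> //; have [M1 HM1] := HI; have [M2 HM2] := HJ; split.
  (* This pair may differ from (a, b); uniqueness of the form makes the choice irrelevant. *)
  move=> [a' [b' [aI' bJ' H]]].
  suff : bihilb_form (fun r s => colen (I ^+ r * J ^+ s)) p0 q0
    (colen (pri a' + pri b'))%:Z p1 q1 (p2 + q2) by apply: bihilb_form_uniq HIJ.
  exists (M1 + M2)%N => r s Mr Ms.
  rewrite (jrel0_colen r s aI' bJ' H) Posz_mul_add.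
  by rewrite HM1 ?HM2; [ring | lia | lia].
move=> [E10 E01 E00]; exists a, b; split=> //.
have [M3 HM3] := HIJ.
have [n [Mn1 Mn2 Mn3]] : exists n, [/\ M1 <= n.+1, M2 <= n.+1 & M3 <= n.+1]%N.
  by exists (M1 + M2 + M3)%N; split; lia.
apply: (jrel0_of_colen (N := n) aI bJ ab Sa Sb).
apply/eqP; rewrite -eqz_nat; apply/eqP.
rewrite HM3 // Posz_mul_add HM1 // HM2 // E10 E01 E00.
by ring.
Qed.

End JointReductionZero.

(** * Hilbert coefficients *)

Section QuotientLength.
Context {R : comPzRingType}.
Implicit Types (K : ideal R).

Lemma of_ideal_mem K (x : R) : (x \in of_ideal K) = (x \in K).
Proof. by []. Qed.

Lemma to_quot_mod_eq (V : lmodType R) (N : submodule V) (u v : V) :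
  (to_quot_mod N u == to_quot_mod N v) = (u - v \in N).
Proof. by rewrite Quotient.idealrBE. Qed.

Lemma quot_mod_chain K n :
  (exists N : nat -> submodule (quot_mod K), strict_chain N n) <->
  chain_above (of_ideal K) n.
Proof.
split=> [[N Ns]|[N KN Ns]].
  pose p i : {pred R^o} := fun x => to_quot_mod K x \in N i.
  have pc i : submod_closed (p i).
    split=> [|c x y xN yN]; rewrite -[_ \in _]/(to_quot_mod K _ \in N i).
      have -> : to_quot_mod K 0 = 0 by apply: raddf0.
      exact: rpred0.
    rewrite to_quot_modD -to_quot_modZ.
    by apply: rpredD => //; apply: (rpredZ c).
  exists (fun i => Idl (pc i)) => [x xK|i lt_in].
    suff E : to_quot_mod K x = 0.
      by rewrite -[_ \in _]/(to_quot_mod K x \in N 0%N) E rpred0.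
    have -> : 0 = to_quot_mod K 0 by rewrite /to_quot_mod raddf0.
    by apply/eqP; rewrite to_quot_mod_eq subr0.
  have [sN nsN] := Ns i lt_in; split=> [x|H]; first exact: sN.
  by apply: nsN => q; have [x ->] := to_quot_modP q; apply: H.
have KNi i : (i <= n)%N -> {subset of_ideal K <= N i}.
  elim: i => // i IH lt_in x /(IH (ltnW lt_in)).
  by have [+ _] := Ns i lt_in; apply.
pose p i : {pred quot_mod K} :=
  fun q => `[< exists2 x : R, x \in N i & q = to_quot_mod K x >].
have pc i : submod_closed (p i).
  split=> [|c _ _ /asboolP[x xN ->] /asboolP[y yN ->]]; apply/asboolP.
    by exists 0; rewrite ?idl_mem0 // /to_quot_mod raddf0.
  exists (c * x + y); first by apply: idlD => //; apply: idlMl.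
  by rewrite to_quot_modD -to_quot_modZ.
exists (fun i => Submodule (pc i)) => i lt_in.
have [sN nsN] := Ns i lt_in; split.
  by move=> q /asboolP[x xN ->]; apply/asboolP; exists x => //; apply: sN.
move=> H; apply: nsN => x xN.
have /H/asboolP[y yN /eqP] : to_quot_mod K x \in Submodule (pc i.+1).
  by apply/asboolP; exists x.
rewrite to_quot_mod_eq => xyK; rewrite -[x](subrK y); apply: idlD => //.
exact: KNi (ltnW lt_in) _ xyK.
Qed.

Lemma has_length_colen K l : colfin (of_ideal K) ->
  has_length (quot_mod K) l <-> l = colen (of_ideal K).
Proof.
move=> /colenP[Kc Kmax]; split=> [[/quot_mod_chain Kl lmax]|->]; last first.
  by split=> [|k /quot_mod_chain/Kmax //]; apply/quot_mod_chain.
apply/eqP; rewrite eqn_leq Kmax //=.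
exact/lmax/quot_mod_chain.
Qed.

Lemma subquot_eq0 (V : lmodType R) (N N' : submodule V) :
  (forall z : subquot N N', z = 0) <-> {subset N <= N'}.
Proof.
pose P := Submodule (@restrict_closed _ _ N N').
have zE : (0 : quot_mod P) = to_quot_mod P 0 by rewrite /to_quot_mod raddf0.
split=> [H x xN|NN z].
  have /eqP := H (to_quot_mod P (exist _ x xN)).
  by rewrite zE to_quot_mod_eq subr0.
have [[x xN] ->] := to_quot_modP z; apply/eqP.
by rewrite zE to_quot_mod_eq subr0; apply: NN.
Qed.

End QuotientLength.

Section HilbertInterface.
Context {R : comNzRingType} {m : idl R} (Rm : noeth_local m).
Implicit Types (I J K : ideal R).

Lemma is_hilbert_coeffE K e : mprim m (of_ideal K) ->
  is_hilbert_coeff K e <->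
  hilb_form (fun n => colen (of_ideal K ^+ n)) (e 0%N) (e 1%N) (e 2%N).
Proof.
move=> mK.
have len n : has_length (quot_mod (K ^+ n)%Idl) (colen (of_ideal K ^+ n)).
  rewrite -of_idealX; apply/has_length_colen => //.
  by rewrite of_idealX; apply/(mprim_colfin Rm)/mprimX.
split=> [[N HN]|[N HN]]; exists N => n /HN.
  move=> [l /has_length_colen + <-]; rewrite of_idealX => -> //.
  exact/(mprim_colfin Rm)/mprimX.
by move=> E; exists (colen (of_ideal K ^+ n)).
Qed.

(** Existence of the form makes the choice by [xget] meaningful, uniqueness identifies its
    values. *)
Lemma hilbert_coeffE K e0 e1 e2 : mprim m (of_ideal K) ->
  hilb_form (fun n => colen (of_ideal K ^+ n)) e0 e1 e2 ->
  hilbert_coeff K 1%N = e1 /\ hilbert_coeff K 2%N = e2.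
Proof.
move=> mK He; pose e i : int := if i is i'.+1 then if i' is 0%N then e1 else e2
  else e0.
have /(is_hilbert_coeffE _ mK) : is_hilbert_coeff K (hilbert_coeff K).
  by apply: (@xgetPex _ _ (is_hilbert_coeff K)); exists e;
    apply/is_hilbert_coeffE.
by move=> H; have [_ -> ->] := hilb_form_uniq H He.
Qed.

Lemma is_bigraded_coeffE I J e : mprim m (of_ideal I) -> mprim m (of_ideal J) ->
  is_bigraded_coeff I J e <->
  bihilb_form (fun r s => colen (of_ideal I ^+ r * of_ideal J ^+ s))
    (e 2 0)%N (e 0 2)%N (e 1 1)%N (e 1 0)%N (e 0 1)%N (e 0 0)%N.
Proof.
move=> mI mJ; have fin r s : colfin (of_ideal I ^+ r * of_ideal J ^+ s).
  by apply/(mprim_colfin Rm)/mprimM; apply: mprimX.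
have len r s : has_length (quot_mod (I ^+ r * J ^+ s)%Idl)
    (colen (of_ideal I ^+ r * of_ideal J ^+ s)).
  by rewrite -!of_idealX -of_idealM; apply/has_length_colen;
    rewrite ?of_idealM ?of_idealX.
have sumE r s : \sum_(i < 3) \sum_(j < 3 | (i + j <= 2)%N)
        (-1) ^+ (i + j) * e i j *
        'C((r + i).-1, i)%:Z * 'C((s + j).-1, j)%:Z =
    e 2%N 0%N * 'C(r.+1, 2)%:Z + e 0%N 2%N * 'C(s.+1, 2)%:Z +
    e 1%N 1%N * (r%:Z * s%:Z) - e 1%N 0%N * r%:Z - e 0%N 1%N * s%:Z +
    e 0%N 0%N :> int.
  under eq_bigr => i _ do rewrite big_mkcond !big_ord_recl big_ord0.
  rewrite !big_ord_recl big_ord0 /=.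
  rewrite /bump /= !addn0 !addnS !addn0 !bin0 !bin1 /= !exprS expr0.
  by ring.
split=> [[N HN]|[N HN]]; exists N => r s Nr Ns; have := HN r s Nr Ns.
  move=> [l /has_length_colen]; rewrite of_idealM !of_idealX => -> //.
  by rewrite sumE.
by move=> E; exists (colen (of_ideal I ^+ r * of_ideal J ^+ s)); rewrite ?sumE.
Qed.

Lemma bigraded_coeffE I J e20 e02 e11 e10 e01 e00 :
  mprim m (of_ideal I) -> mprim m (of_ideal J) ->
  bihilb_form (fun r s => colen (of_ideal I ^+ r * of_ideal J ^+ s))
    e20 e02 e11 e10 e01 e00 ->
  bigraded_coeff I J 1%N 0%N = e10 /\ bigraded_coeff I J 0%N 1%N = e01.
Proof.
move=> mI mJ He; pose e i j : int := match i, j with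
  | 2, 0 => e20 | 0, 2 => e02 | 1, 1 => e11 | 1, 0 => e10 | 0, 1 => e01
  | _, _ => e00 end%N.
have /(is_bigraded_coeffE _ mI mJ) : is_bigraded_coeff I J (bigraded_coeff I J).
  by apply: (@xgetPex _ _ (is_bigraded_coeff I J)); exists e;
    apply/is_bigraded_coeffE.
by move=> H; have [-> -> _] := bihilb_form_uniq H He.
Qed.

End HilbertInterface.

(** * Cohen-Macaulay rings and associated graded rings *)

Section CohenMacaulay.
Context {R : comNzRingType} (m0 : ideal R).
Hypotheses (m_local : is_local m0) (R_noeth : noetherian R).
Implicit Types (A K P Q : idl R) (x y z : R).

Let m : idl R := of_ideal m0.

Lemma is_local_noeth : noeth_local m.
Proof.
have [[m1 mmax] muniq] := m_local; split=> //.
  move=> x xm; have [[y]|nx] := pselect (exists y, x * y = 1); first by exists y.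
  have [|P [xP P1 Pmax]] := @max_disjoint _ (pri x) [set 1].
    by move=> _ /inpriP[y ->] /= E; apply: nx; exists y.
  have /muniq Pm : maximal_ideal P.
    split=> [|I I1 PI]; first by apply/negP => /P1; apply.
    apply: (Pmax (of_ideal I)) => // z zI /= z1.
    by rewrite z1 in zI; case/negP: I1.
  by case/negP: xm; rewrite /m of_ideal_mem -Pm; apply: xP; apply: mem_pri.
move=> A; have [s As] := R_noeth A; exists s.
by rewrite -ideal_gen_seq -[LHS]idl_idealK; congr of_ideal; apply: ideal_ext.
Qed.

Let Rm := is_local_noeth.

Lemma mprim_of_nilpotent K : (forall z, z \in m -> exists n, z ^+ n \in K) ->
  mprim m K.
Proof.
have [s E] := local_noeth Rm m => H.
have {H} : forall z, z \in s -> exists n, z ^+ n \in K.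
  by move=> z zs; apply: H; rewrite E; apply: mem_gens.
rewrite /mprim E; elim: s {E} => [|x s IH] H.
  by exists 1%N; rewrite expr1 gens_nil => z; rewrite in_idl0 => /eqP->;
    apply: idl_mem0.
have [n xn] := H x (mem_head _ _).
have [|k sk] := IH; first by move=> z zs; apply: H; rewrite inE zs orbT.
exists (n + k)%N; rewrite gens_cons => z /idl_exp_add; apply: add_sub z => //.
by rewrite -priX; apply: pri_sub.
Qed.

Lemma primary_sub_mprim I : is_primary_to m0 I ->
  {subset of_ideal I <= m} /\ mprim m (of_ideal I).
Proof.
move=> [_ Im]; split.
  move=> x xI; rewrite of_ideal_mem -Im; apply/asboolP; exists 1%N.
  by rewrite expr1.
apply: mprim_of_nilpotent => z zm.
by have /asboolP : z \in radical I by rewrite Im.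
Qed.

(* If some prime [P] other than [m] contains [x] and [y], regularity provides
   primes [P0], [P1] with [P0 < P1 < P < m]. *)
Lemma regular_mprim x y : krull_dim R 2 -> x \in m -> y \in m ->
  nzd x -> regmod x y -> mprim m (pri x + pri y).
Proof.
move=> [_ dim2] xm ym nx rxy; apply: mprim_of_nilpotent => z zm.
apply: contrapT => nz.
have [||w wK [n zw]|P [KP Pz Pp]] :=
  @prime_disjoint _ (pri x + pri y) [set w | exists n, w = z ^+ n].
- by exists 0%N.
- by move=> _ _ [i ->] [j ->]; exists (i + j)%N; rewrite exprD.
- by apply: nz; exists n; rewrite -zw.
have xP : x \in P by apply/KP/sub_addl/mem_pri.
have yP : y \in P by apply/KP/sub_addr/mem_pri.
have P1 : (1 : R) \notin P by apply/negP => /Pz; apply; exists 0%N.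
have Pm : {subset P <= m}.
  by have [//|P_1] := sub_or_eq1 Rm P; move: P1; rewrite P_1 idl1.
(* Avoiding all y^k s with s outside [P] forces [P'] into [P] (k = 0) and [y] out of [P'] (s = 1).
   The same device with [x] and [P'] produces [P0]. *)
have [|||P' [xP' P'S Pp']] := @prime_disjoint _ (pri x)
  [set w | exists k s, s \notin P /\ w = y ^+ k * s].
- by exists 0%N, 1; rewrite mul1r.
- move=> _ _ [i [s [sP ->]]] [j [t [tP ->]]]; exists (i + j)%N, (s * t).
  by split; [apply/negP => /Pp[]; apply/negP | rewrite exprD; ring].
- move=> _ /inpriP[p ->] [k [s [sP E]]].
  have [t Et] := regmodXr (n := k) rxy E.
  by case/negP: sP; rewrite Et; apply: idlMr.
have P'P : {subset P' <= P}.
  move=> w wP'; apply: contrapT => /negP wP; apply: (P'S w wP').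
  by exists 0%N, w; rewrite mul1r.
have yP' : y \notin P'.
  by apply/negP => /P'S; apply; exists 1%N, 1; rewrite mulr1.
have P'1 : (1 : R) \notin P' by apply: contra P1 => /P'P.
have [|||P0 [_ P0S Pp0]] := @prime_disjoint _ (0 : idl R)
  [set w | exists k s, s \notin P' /\ w = x ^+ k * s].
- by exists 0%N, 1; rewrite mul1r.
- move=> _ _ [i [s [sP ->]]] [j [t [tP ->]]]; exists (i + j)%N, (s * t).
  by split; [apply/negP => /Pp'[]; apply/negP | rewrite exprD; ring].
- move=> w; rewrite in_idl0 => /eqP-> [k [s [/negP sP /esym E]]].
  by apply: sP; rewrite (nzdX nx E) idl_mem0.
have P0P : {subset P0 <= P'}.
  move=> w wP0; apply: contrapT => /negP wP; apply: (P0S w wP0).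
  by exists 0%N, w; rewrite mul1r.
have xP0 : x \notin P0.
  by apply/negP => /P0S; apply; exists 1%N, 1; rewrite mulr1.
have P01 : (1 : R) \notin P0 by apply: contra P'1 => /P0P.
have prime A : (1 : R) \notin A ->
    (forall u v, u * v \in A -> u \in A \/ v \in A) -> prime_ideal A.
  by move=> A1 Ap; split=> // u v /Ap[] uA; apply/orP; [left|right].
pose C i : ideal R := match i with 0 => P0 | 1 => P' | 2 => P | _ => m end%N.
suff /dim2 : exists D : nat -> ideal R,
    (forall i, (i <= 3)%N -> prime_ideal (D i)) /\ strict_chain D 3 by [].
exists C; split=> [[|[|[|i]]] _ /=|[|[|[|//]]] _ /=].
- exact: prime.
- exact: prime.
- exact: prime.
- apply: prime; first exact: local_proper Rm.
  move=> u v uv; have [uA|nu] := boolP (u \in m); first by left.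
  by right; apply: (local_prime Rm uv).
- by split=> // H; case/negP: xP0; apply: H; apply: xP'; apply: mem_pri.
- by split=> // H; case/negP: yP'; apply: H.
- by split=> // H; apply: (Pz z); [apply: H | exists 1%N].
Qed.

Lemma infinite_distinct : infinite_set [set: quot_ring m0] ->
  forall n, exists2 ts : seq R, distinct_mod (m := m) ts & size ts = n.
Proof.
move=> inf; elim=> [|n [ts dts sz]]; first by exists [::].
have [q qts] : exists q : quot_ring m0, q \notin map (to_quot m0) ts.
  apply: contrapT => H; apply: inf.
  apply: (@sub_finite_set _ _ [set` map (to_quot m0) ts]); last exact: finite_seq.
  by move=> q _ /=; apply: contrapT => /negP nq; apply: H; exists q.
have [t Et] := to_quotP q; exists (t :: ts); last by rewrite /= sz.
rewrite /distinct_mod pairwise_cons; apply/andP; split=> //.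
apply/allP => u uts; apply: contra qts; rewrite Et => tu.
apply/mapP; exists u => //; apply/eqP.
by rewrite /to_quot -Quotient.idealrBE.
Qed.

Lemma cohen_macaulay_cm2 : cohen_macaulay m0 -> krull_dim R 2 ->
  infinite_set [set: quot_ring m0] -> local_cm2 m.
Proof.
move=> [_ [d dim_d [dep _]]] dim2 inf; split=> //; first exact: infinite_distinct.
have Ed : d = 2%N.
  have [[c1 m1] [c2 m2]] := (dim_d, dim2).
  by apply/eqP; rewrite eqn_leq m2 ?m1.
have [[|x [|y [|z s]]] [sz sm [_ reg]]] := dep; rewrite ?Ed // in sz.
have xm : x \in m by apply: sm; rewrite mem_head.
have ym : y \in m by apply: sm; rewrite !inE eqxx orbT.
have genE (s : seq R) : ideal_gen [set` s] = gens s.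
  by rewrite -ideal_gen_seq of_idealK.
have nx : nzd x.
  move=> u xu; have := reg 0%N isT u.
  rewrite -[take _ _]/[::] -[_`_0]/x genE -!of_ideal_mem idl_idealK gens_nil xu.
  by rewrite idl_mem0 in_idl0 => /(_ isT)/eqP.
have rxy : regmod x y.
  move=> p q E; have := reg 1%N isT q.
  rewrite -[take _ _]/[:: x] -[_`_1]/y genE -!of_ideal_mem idl_idealK.
  rewrite gens_cons gens_nil addr0 -E => H.
  have /inpriP[t ->] : q \in pri x by apply: H; apply/inpriP; exists p.
  by exists t.
have mxy := regular_mprim dim2 xm ym nx rxy.
exists x, y; split=> //.
exact: (regpair_prim Rm xm ym xm ym nx rxy mxy).
Qed.

End CohenMacaulay.

(** * Depth of the associated graded ring *)

Section DepthClosed.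
Context {R : comNzRingType} (m0 I0 : ideal R).
Hypothesis I_primary : is_primary_to m0 I0.

Let I : idl R := of_ideal I0.
Let Gr := Submodule (gr_ideal_closed I0).

Lemma rees_coef (p : rees I0) n : (val p)`_n \in I ^+ n.
Proof. by have /asboolP/(_ n) := valP p; rewrite -of_ideal_mem of_idealX. Qed.

Lemma in_gr_ideal (p : rees I0) :
  (p \in Gr) <-> (forall n, (val p)`_n \in I ^+ n.+1).
Proof.
split=> [/asboolP H n|H]; last apply/asboolP => n.
  by have := H n; rewrite -of_ideal_mem of_idealX.
by rewrite -of_ideal_mem of_idealX.
Qed.

Lemma to_gr_eq0 (p : rees I0) : (to_quot Gr p == 0) = (p \in Gr).
Proof.
have -> : 0 = to_quot Gr 0 by rewrite /to_quot raddf0.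
by rewrite -[LHS]Quotient.idealrBE subr0.
Qed.

(** The generating set of [gr_max] is already an ideal. *)
Lemma gr_maxP (g : assoc_graded I0) : g \in gr_max I0 m0 ->
  exists2 p : rees I0, (val p)`_0 \in m0 & g = to_quot Gr p.
Proof.
pose P : {pred (assoc_graded I0)^o} := fun g =>
  `[< exists2 p : rees I0, (val p)`_0 \in m0 & g = to_quot Gr p >].
have Pc : submod_closed P.
  split=> [|c _ _ /asboolP[p pm ->] /asboolP[q qm ->]]; apply/asboolP.
    exists 0; last by rewrite /to_quot raddf0.
    by rewrite raddf0 coef0 mem_ideal0.
  have [r ->] := to_quotP c; exists (r * p + q).
    rewrite rmorphD rmorphM coefD coef0M.
    by apply: mem_idealD => //; apply: mem_idealMl.
  by rewrite to_quotD -to_quotM.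
move=> /(ideal_gen_min (K := Submodule Pc)) H; apply/asboolP/H.
by move=> _ [p pm <-]; apply/asboolP; exists p.
Qed.

Lemma depth_nzd : depth_ge (gr_max I0 m0) 1 ->
  exists2 p : rees I0, (val p)`_0 \in m0 & nzd (to_quot Gr p : assoc_graded I0).
Proof.
move=> [n n_gt0 [[|g s] [/= sz gm [_ reg]]]]; first by rewrite -sz in n_gt0.
have [p pm Eg] := gr_maxP (gm g (mem_head _ _)).
exists p; rewrite // -Eg => y gy0.
have := reg 0%N isT y; rewrite -[take _ _]/[::] -[_`_0]/g gy0.
rewrite -!of_ideal_mem ideal_gen_seq gens_nil idl_mem0 in_idl0.
by move=> /(_ isT)/eqP.
Qed.

Lemma mono_rees n z : z \in I ^+ n -> z *: 'X^n \in rees_pred I0.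
Proof.
move=> zI; apply/asboolP => k; rewrite coefZ coefXn.
have [->|_] := eqVneq k n; last by rewrite mulr0 mem_ideal0.
by rewrite mulr1 -of_ideal_mem of_idealX.
Qed.

(* If [p] represents a non-zero-divisor and the constant term of [p ^+ k] is in
   [I], then [p ^+ k * z t^n] vanishes in [G(I)], hence so does [z t^n]. *)
Lemma depth_closed1 : depth_ge (gr_max I0 m0) 1 -> forall n z, z \in I ^+ n ->
  (forall x, x \in I -> z * x \in I ^+ n.+2) -> z \in I ^+ n.+1.
Proof.
move=> /depth_nzd[p pm np] n z zI Hz.
have [k pk] : exists k, (val p)`_0 ^+ k \in I0.
  by have [_ rad] := I_primary; move: pm; rewrite -rad => /asboolP.
pose q : rees I0 := exist (fun u => u \in rees_pred I0) _ (mono_rees zI).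
suff /in_gr_ideal/(_ n) : q \in Gr by rewrite /= coefZ coefXn eqxx mulr1.
rewrite -to_gr_eq0; apply/eqP; apply: (nzdX (n := k) np).
have toX : (to_quot Gr p : assoc_graded I0) ^+ k = to_quot Gr (p ^+ k).
  by elim: (k) => [|j IH] //; rewrite !exprS IH -to_quotM.
rewrite toX -[LHS]/(quot_mul _ _) to_quotM; apply/eqP; rewrite to_gr_eq0.
apply/in_gr_ideal => j; rewrite rmorphM rmorphXn /= -scalerAr coefZ coefMXn.
case: ltnP => [_|/subnKC <-]; first by rewrite mulr0 idl_mem0.
rewrite addKn; move: (j - n)%N => {j} [|i].
  have coef0X (u : {poly R}) j : (u ^+ j)`_0 = u`_0 ^+ j.
    by elim: j => [|j IH]; rewrite ?expr0 ?coef1 // !exprS coef0M IH.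
  by rewrite addn0 exprSr coef0X; apply: idlM.
have ui : (val p ^+ k)`_i.+1 \in I ^+ i.+1.
  by rewrite -rmorphXn; apply: rees_coef.
have zI2 : {subset pri z * I <= I ^+ n.+2}.
  by move=> _ /priP[x xI ->]; apply: Hz.
(* One factor in [I] of this coefficient moves [z] into I^(n+2), one power higher than its degree;
   the other factors lie in I^i. *)
have -> : (n + i.+1).+1 = (n.+2 + i)%N by lia.
rewrite exprD; apply: (idl_mulSl zI2).
by rewrite -mulrA -exprS; apply: idlM => //; apply: mem_pri.
Qed.

(** The order of [z] is raised one step at a time: as long as k < n, z I lies in I^(n+1), hence in
    I^(k+2). *)
Lemma depth_closed : depth_ge (gr_max I0 m0) 1 -> forall n z,
  (forall x, x \in I -> z * x \in I ^+ n.+1) -> z \in I ^+ n.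
Proof.
move=> dep n z Hz; suff H k : (k <= n)%N -> z \in I ^+ k by apply: H.
elim: k => [_|k IH lt_kn]; first exact: idl1.
apply: (depth_closed1 dep) => [|x xI]; first exact: IH (ltnW lt_kn).
exact: (@idl_exp_le _ I k.+2 n.+1 lt_kn _ (Hz x xI)).
Qed.

End DepthClosed.

(** * Translation to the stated notions and conclusion *)

Section FinalInterface.
Context {R : comNzRingType}.
Implicit Types (I J X Y : ideal R).

Lemma of_ideal_eqi X Y : X =i Y <-> of_ideal X = of_ideal Y.
Proof.
split=> [XY|XY x]; first exact: idl_ext.
by rewrite -!of_ideal_mem XY.
Qed.

Lemma jrel_eq (A B : idl R) a b r s : a \in A -> b \in B ->
  jrel A B a b r s -> A ^+ r.+1 * B ^+ s.+1 =
    pri a * (A ^+ r * B ^+ s.+1) + pri b * (A ^+ r.+1 * B ^+ s).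
Proof.
move=> aA bB H; apply: idl_anti => //; apply: add_sub => x.
  by move=> /(pri_mulS aA); rewrite mulrA -exprS.
by move=> /(pri_mulS bB); rewrite mulrCA -exprS.
Qed.

Lemma jrel0_joint_reduction I J a b : a \in I -> b \in J ->
  jrel (of_ideal I) (of_ideal J) a b 0 0 -> joint_reduction I J a b.
Proof.
move=> aI bJ H; split=> //; exists 0%N => r s _ _; apply/of_ideal_eqi.
rewrite of_idealD !of_idealM !of_idealX -!exprS.
exact: (@jrel_eq (of_ideal I) (of_ideal J) a b r s aI bJ
  (jrel_le (leq0n r) (leq0n s) H)).
Qed.

Lemma joint_reduction_number_zeroE I J :
  joint_reduction_number_zero I J <-> exists a b,
  [/\ a \in of_ideal I, b \in of_ideal J &
      jrel (of_ideal I) (of_ideal J) a b 0 0].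
Proof.
split=> [[a [b [[aI bJ _] /of_ideal_eqi]]]|[a [b [aI bJ H]]]].
  rewrite of_idealD !of_idealM => E; exists a, b; split=> //.
  by rewrite /jrel !expr1 !expr0 mul1r mulr1 E.
exists a, b; split; first exact: jrel0_joint_reduction.
apply/of_ideal_eqi; rewrite of_idealD !of_idealM.
by have := jrel_eq aI bJ H; rewrite !expr1 !expr0 mul1r mulr1.
Qed.

Lemma M1_eq0 I J a b k :
  (forall z : M1 I J 0 0 a b k, z = 0) <->
  {subset of_ideal I ^+ k * of_ideal J ^+ k <=
    pri (a ^+ k) * of_ideal J ^+ k + pri (b ^+ k) * of_ideal I ^+ k}.
Proof.
have <- : of_ideal (I ^+ (0 + k) * J ^+ (0 + k))%Idl =
    of_ideal I ^+ k * of_ideal J ^+ k by rewrite of_idealM !of_idealX.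
have <- : of_ideal (a ^+ k *: (I ^+ 0 * J ^+ (0 + k)) +
    b ^+ k *: (I ^+ (0 + k) * J ^+ 0))%Idl =
    pri (a ^+ k) * of_ideal J ^+ k + pri (b ^+ k) * of_ideal I ^+ k.
  by rewrite of_idealD !of_idealM !of_idealX !expr0 mul1r mulr1.
exact: subquot_eq0.
Qed.

End FinalInterface.

Theorem theorem3p28 (R : comNzRingType) (m I J : ideal R)
  (R_local : is_local m)
  (R_CM : cohen_macaulay m)
  (R_dim2 : krull_dim R 2)
  (R_infinite_residue : infinite_set [set: quot_ring m])
  (I_primary : is_primary_to m I)
  (J_primary : is_primary_to m J)
  (I_depth : depth_ge (gr_max I m) 1)
  (J_depth : depth_ge (gr_max J m) 1) :
  let a := joint_reduction_number_zero I J in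
  let b := [/\ bigraded_coeff I J 1%N 0%N = hilbert_coeff I 1%N,
               bigraded_coeff I J 0%N 1%N = hilbert_coeff J 1%N
             & hilbert_coeff (I * J)%Idl 2%N =
               hilbert_coeff I 2%N + hilbert_coeff J 2%N] in
  let c := exists x y : R, joint_reduction I J x y /\
             forall k, (1 <= k)%N -> forall z : M1 I J 0 0 x y k, z = 0 in
  (a <-> b) /\ (b <-> c).
Proof.
move=> a b c.
have R_noeth := proj1 R_CM.
have Rm := cohen_macaulay_cm2 R_local R_noeth R_CM R_dim2 R_infinite_residue.
have Rn := cm2_noeth Rm.
have [Im mI] := primary_sub_mprim R_local R_noeth I_primary.
have [Jm mJ] := primary_sub_mprim R_local R_noeth J_primary.
have [p0 [p1 [p2 [q0 [q1 [q2 [c11 [c10 [c01 [c00 [HI HJ HIJ zero]]]]]]]]]]] :=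
  jrel0_hilbert Rm Im Jm mI mJ (depth_closed I_primary I_depth)
    (depth_closed J_primary J_depth).
have mIJ : mprim (of_ideal m) (of_ideal (I * J)%Idl).
  by rewrite of_idealM; apply: mprimM.
have [eI1 eI2] := hilbert_coeffE Rn mI HI.
have [eJ1 eJ2] := hilbert_coeffE Rn mJ HJ.
have [e10 e01] := bigraded_coeffE Rn mI mJ HIJ.
(* Since (I J)^n = I^n J^n, the Hilbert polynomial of [I J] is the diagonal of the bigraded one. *)
have [_ eIJ] := hilbert_coeffE Rn mIJ
  (e0 := p0 + q0 + 2 * c11) (e1 := c11 + c10 + c01) (e2 := c00) ltac:(
  by have [N HN] := bihilb_diag HIJ; exists N => n /HN <-;
     rewrite of_idealM exprMn).
rewrite -joint_reduction_number_zeroE in zero.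
have ab : a <-> b by rewrite /b eI1 eI2 eJ1 eJ2 e10 e01 eIJ.
split=> //; rewrite -ab /a joint_reduction_number_zeroE.
(* One pair serves for all [k] by [jrel0_power]; conversely, (c) for k = 1 is already I J = x J + y
   I. *)
split=> [[x [y [xI yJ H]]]|[x [y [[xI yJ _] H]]]]; exists x, y.
  split=> [|k _]; first exact: jrel0_joint_reduction.
  apply/M1_eq0; have := jrel0_power k k xI yJ H.
  by move=> ->.
split=> //; have /M1_eq0 := H 1%N isT.
by rewrite /jrel !expr1 !expr0 mul1r mulr1.
Qed.
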